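(* Let $\{\omega_n\}_{n\ge1}$ be a sequence of complex numbers and $\{\rho_n\}_{n\ge1}$ a sequence of real numbers such that, for some $\gamma,\alpha_\omega>0$ and $\alpha_\rho<0$, $$\liminf_{n\to\infty}\big(\Re\omega_{n+1}-\Re\omega_n\big)=\gamma,\qquad \lim_{n\to\infty}\Im\omega_n=\alpha_\omega,\qquad \lim_{n\to\infty}\rho_n=\alpha_\rho,$$ and $\gamma>4\alpha_\omega$. Put $\omega_{-n}:=-\overline{\omega_n}$ for $n\ge1$. Assume that the numbers $\omega_n$, $n\in\mathbb Z\setminus\{0\}$, are non-zero and pairwise distinct, that the numbers $\rho_n$, $n\ge1$, are non-zero and pairwise distinct, and that $\rho_n\ne i\omega_m$ for all $n\ge1$ and $m\in\mathbb Z\setminus\{0\}$. Let $\nu>1/2$ and $M>0$. Then for every $$T>\frac{2\pi}{\sqrt{\gamma^2-16\alpha_\omega^2}}$$ there exists a constant $C=C(T)>0$ such that $$\int_0^T\Big(\sum_{n=1}^\infty C_ne^{i\omega_nt}+\overline{C_n}e^{-i\overline{\omega_n}t}+R_{1,n}+R_{2,n}e^{\rho_nt}\Big)^2dt\ \ge\ C\sum_{n=1}^\infty\big(1+e^{-2\Im\omega_nT}\big)|C_n|^2$$ for all sequences of complex numbers $\{C_n\}_{n\ge1}$ with $\sum_{n=1}^\infty|C_n|^2<+\infty$ and all sequences of real numbers $\{R_{1,n}\}_{n\ge1}$, $\{R_{2,n}\}_{n\ge1}$ satisfying $$|R_{1,n}|+|R_{2,n}|\le\frac{M}{n^\nu}|C_n|\qquad\text{for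 all } n\ge1.$$
   Context: $\Re$ and $\Im$ denote real and imaginary parts. The series in the integrand (each summand consisting of all four terms) is understood as converging in $L^2(0,T)$. *)

(* Defs.v *)
From HB Require Import structures.
From mathcomp Require Import all_boot all_order all_algebra.
From mathcomp Require Import all_classical all_reals all_analysis.
From mathcomp Require Import complex.
Import Order.TTheory GRing.Theory Num.Theory.
Import numFieldNormedType.Exports.

Set Implicit Arguments.
Unset Strict Implicit.
Unset Printing Implicit Defensive.

Local Open Scope classical_set_scope.
Local Open Scope ring_scope.
Local Open Scope complex_scope.

(* Sequences indexed by n >= 1 are functions on nat whose value at 0 is never
   used. *)

Definition cexp (R : realType) (z : R[i]) : R[i] :=
  (expR (complex.Re z))%:C *
  (cos (complex.Im z) +i* sin (complex.Im z)).

(* omega_{-n} := - conj omega_n for n >= 1; recall that Negz n is -(n+1). *)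
Definition freqZ (R : realType) (omega : nat -> R[i]) (k : int) : R[i] :=
  match k with
  | Posz n => omega n
  | Negz n => - (omega n.+1)^*%C
  end.

Definition summand (R : realType) (omega : nat -> R[i]) (rho : nat -> R)
    (c : nat -> R[i]) (r1 r2 : nat -> R) (n : nat) (t : R) : R[i] :=
  c n * cexp ('i%C * omega n * t%:C)
  + (c n)^*%C * cexp (- 'i%C * (omega n)^*%C * t%:C)
  + (r1 n)%:C + (r2 n * expR (rho n * t))%:C.

Lemma cexp_conj (R : realType) (z : R[i]) : cexp z^*%C = (cexp z)^*%C.
Proof.
case: z => a b; rewrite /cexp /= cosN sinN.
by apply/eqP; rewrite eq_complex /= !mul0r subr0 !addr0 mulrN !eqxx.
Qed.

Lemma summand_real (R : realType) (omega : nat -> R[i]) (rho : nat -> R)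
    (c : nat -> R[i]) (r1 r2 : nat -> R) (n : nat) (t : R) :
  summand omega rho c r1 r2 n t =
  (complex.Re (summand omega rho c r1 r2 n t))%:C.
Proof.
rewrite /summand.
have -> : - 'i%C * (omega n)^*%C * t%:C = ('i%C * omega n * t%:C)^*%C.
  case: (omega n) => a b; apply/eqP; rewrite eq_complex /=.
  by rewrite !(mul0r, mulr0, mul1r, subr0, addr0, add0r, oppr0, sub0r,
               mulN1r, opprK, mulNr, mulrN, eqxx).
rewrite cexp_conj; case: (c n) => a b; case: (cexp _) => x y.
apply/eqP; rewrite eq_complex /= eqxx /= !addr0 mulrN mulNr.
by rewrite addrACA !subrr addr0.
Qed.

(* f is the sum in L^2(0,T) of the real series \sum_{n >= 1} u n. *)
Definition L2_series_sum (R : realType) (T : R) (u : nat -> R -> R)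
    (f : R -> R) : Prop :=
  [/\ measurable_fun `]0, T[%classic f,
      (\int[lebesgue_measure]_(t in `]0%R, T[) ((f t) ^+ 2)%:E < +oo)%E &
      (fun N : nat => \int[lebesgue_measure]_(t in `]0%R, T[)
          ((f t - \sum_(1 <= n < N) u n t) ^+ 2)%:E)%E @ \oo --> 0%E].

(* Main.v *)
Require Import Defs.
From HB Require Import structures.
From mathcomp Require Import all_boot all_order all_algebra.
From mathcomp Require Import all_classical all_reals all_analysis.
From mathcomp Require Import measurable_realfun complex zify ring lra.
Import Order.TTheory GRing.Theory Num.Theory.
Import numFieldNormedType.Exports.
Local Open Scope classical_set_scope.
Local Open Scope ring_scope.
Local Open Scope complex_scope.

(** The estimates are proved for finite sums, with constants that do not
    depend on the number of terms; the series and its sum appear only at the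
    end. The exponents are i omega_k (k a nonzero integer), 0, and the
    rho_n.

    High frequencies. For |k| large the real parts of the omega_k are
    separated by a gap g close to gamma and the imaginary parts lie between
    0 and a bound beta close to alpha_omega. Ingham's method integrates the
    square of an exponential sum against sin (th (t - lo)) over a half
    period [lo, hi]. The resulting quadratic form has the entries th (e^(z
    lo) + e^(z hi)) / (z^2 + th^2), where z is the sum of one exponent and
    the conjugate of another. On the diagonal this is about th / (4 beta^2 +
    th^2). Off the diagonal the denominator is at least g^2 (m^2 - 1/4), m
    being the difference of the indices, provided that 4 beta^2 + th^2 <=
    g^2 / 4; as the sum of 1 / (m^2 - 1/4) over the nonzero integers m is 4,
    the rest of the row adds up to at most 4 th / g^2. (The exponentials in
    the numerator are carried by the coefficients.) Hence the form is
    coercive when 4 beta^2 + th^2 < g^2 / 4, and for th = pi / T this is the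
    condition on T (ingham_sine, inverse_inequality_tail). The same
    computation with a smaller th gives the upper bound
    (direct_inequality_tail).

    Finitely many more exponents. Subtracting from g(t) the mean of e^(- lam
    s) g(t + s) over 0 <= s <= dl multiplies e^(mu t) by 1 - (e^w - 1) / w,
    where w = (mu - lam) dl. This removes the exponent lam, is bounded in L2
    at the price of shortening the interval by dl (deflate_energy), and
    leaves multipliers that are bounded below on the other exponents,
    because e^w = 1 + w has no solution w <> 0 close to the imaginary axis
    (cexp_mean_lower). So one exponent at a time can be added to the family,
    the interval being lengthened by as little as one wishes
    (inverse_inequality_add, frame_above_adds).

    The exponents rho_n. They accumulate at alpha_rho, so that infinitely
    many of them would have to be added, with constants that degenerate
    while the constant M is fixed. Instead only 0 and rho_1, ..., rho_K are
    added. The other terms are made small by applying p times the averaging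
    operator with lam = alpha_rho, on intervals of length (T - T1) / p. No i
    omega_k is real, since omega_k and omega_(-k) differ, so the i omega_k
    keep a positive distance from alpha_rho; choosing K large makes the
    multipliers of the rho_n, n > K, at most half of those of the i omega_k,
    uniformly in the length of the intervals. After p steps the ratio is at
    most 2^(- p), which beats every constant involved, and |R_(2,n)| <= M
    n^(- nu) |C_n| with 2 nu > 1 lets these terms be absorbed
    (block_inverse_inequality).

    Passage to the limit. The upper bound makes the partial sums a Cauchy
    sequence in L2(0, T), hence the series converges (L2_complete), and the
    lower bound for the partial sums passes to the limit. *)

Set Implicit Arguments.
Unset Strict Implicit.
Unset Printing Implicit Defensive.

Local Notation Rez := complex.Re.
Local Notation Imz := complex.Im.
Local Notation normc := Normc.normc.

(** * Complex numbers and the complex exponential *)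

Section ComplexBasics.
Variable R : realType.
Implicit Types (z w : R[i]) (t : R).

Lemma cReD z w : Rez (z + w) = Rez z + Rez w.
Proof. by case: z w => [a b] [c d]. Qed.

Lemma cImD z w : Imz (z + w) = Imz z + Imz w.
Proof. by case: z w => [a b] [c d]. Qed.

Lemma cReN z : Rez (- z) = - Rez z.
Proof. by case: z. Qed.

Lemma cImN z : Imz (- z) = - Imz z.
Proof. by case: z. Qed.

Lemma cReM z w : Rez (z * w) = Rez z * Rez w - Imz z * Imz w.
Proof. by case: z w => [a b] [c d]. Qed.

Lemma cImM z w : Imz (z * w) = Rez z * Imz w + Imz z * Rez w.
Proof. by case: z w => [a b] [c d]. Qed.

Lemma cReZ t z : Rez (t%:C * z) = t * Rez z.
Proof. by rewrite cReM /= mul0r subr0. Qed.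

Lemma cImZ t z : Imz (t%:C * z) = t * Imz z.
Proof. by rewrite cImM /= mul0r addr0. Qed.

Lemma cReJ z : Rez z^*%C = Rez z.
Proof. by case: z. Qed.

Lemma cImJ z : Imz z^*%C = - Imz z.
Proof. by case: z. Qed.

Lemma conjcM z w : (z * w)^*%C = z^*%C * w^*%C.
Proof. exact: rmorphM. Qed.

Lemma conjc_sum (I : Type) (s : seq I) (F : I -> R[i]) :
  (\sum_(i <- s) F i)^*%C = \sum_(i <- s) (F i)^*%C.
Proof. exact: rmorph_sum. Qed.

Lemma Re_sum (I : Type) (s : seq I) (F : I -> R[i]) :
  Rez (\sum_(i <- s) F i) = \sum_(i <- s) Rez (F i).
Proof. by elim: s => [|i s ih]; rewrite ?big_nil // !big_cons cReD ih. Qed.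

Lemma normc_sqr z : normc z ^+ 2 = Rez z ^+ 2 + Imz z ^+ 2.
Proof. by case: z => a b; rewrite /= sqr_sqrtr // addr_ge0 ?sqr_ge0. Qed.

Lemma normc_ge0 z : 0 <= normc z.
Proof. by case: z => a b; rewrite sqrtr_ge0. Qed.

Lemma normc_conj z : normc z^*%C = normc z.
Proof. by case: z => a b; rewrite /= sqrrN. Qed.

Lemma normc_real t : normc t%:C = `|t|.
Proof. by rewrite /= expr0n /= addr0 sqrtr_sqr. Qed.

Lemma Re_le_normc z : `|Rez z| <= normc z.
Proof.
by case: z => a b /=; rewrite -sqrtr_sqr ler_wsqrtr // lerDl sqr_ge0.
Qed.

Lemma Im_le_normc z : `|Imz z| <= normc z.
Proof.
by case: z => a b /=; rewrite -sqrtr_sqr ler_wsqrtr // lerDr sqr_ge0.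
Qed.

Lemma normc_gt0 z : z != 0 -> 0 < normc z.
Proof.
move=> z0; rewrite lt_neqAle normc_ge0 andbT eq_sym.
by apply: contra z0 => /eqP /Normc.eq0_normc ->.
Qed.

Lemma le_normc_sum (I : Type) (s : seq I) (F : I -> R[i]) :
  normc (\sum_(i <- s) F i) <= \sum_(i <- s) normc (F i).
Proof.
elim/big_rec2: _ => [|i y1 y2 _ h]; first by rewrite Normc.normc0.
by rewrite (le_trans (le_normcD _ _)) // lerD2l.
Qed.

Lemma sqr_normcD z w :
  normc (z + w) ^+ 2 <= 2 * normc z ^+ 2 + 2 * normc w ^+ 2.
Proof.
rewrite !normc_sqr cReD cImD -subr_ge0.
rewrite [X in 0 <= X](_ : _ = (Rez z - Rez w) ^+ 2 + (Imz z - Imz w) ^+ 2);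
  last by ring.
by rewrite addr_ge0 ?sqr_ge0.
Qed.

Lemma Re_mulJ_normc z : Rez (z^*%C * z) = normc z ^+ 2.
Proof. by rewrite normc_sqr cReM cReJ cImJ; ring. Qed.

Lemma cexpD z w : cexp (z + w) = cexp z * cexp w.
Proof.
apply/eqP; rewrite eq_complex /cexp !(cReM, cImM, cReD, cImD) /=.
by rewrite expRD cosD sinD; apply/andP; split; apply/eqP; ring.
Qed.

Lemma cexp0 : cexp (0 : R[i]) = 1.
Proof.
apply/eqP; rewrite eq_complex /cexp !(cReM, cImM) /= expR0 cos0 sin0.
by apply/andP; split; apply/eqP; ring.
Qed.

Lemma normc_cexp z : normc (cexp z) = expR (Rez z).
Proof.
apply/eqP; rewrite -(@eqrXn2 _ 2) ?normc_ge0 ?expR_ge0 //.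
rewrite normc_sqr /cexp !(cReM, cImM) /= -[X in _ == X]mulr1 -(cos2Dsin2 (Imz z)).
by apply/eqP; ring.
Qed.

Lemma Re_cexp z : Rez (cexp z) = expR (Rez z) * cos (Imz z).
Proof. by rewrite /cexp cReZ. Qed.

Lemma Im_cexp z : Imz (cexp z) = expR (Rez z) * sin (Imz z).
Proof. by rewrite /cexp cImZ. Qed.

Lemma cexp_real t : cexp t%:C = (expR t)%:C.
Proof. by rewrite /cexp /= cos0 sin0 complexr0 mulr1. Qed.

(** All integrals of exponentials below are integrals of real parts, so that
    this real derivative and the fundamental theorem of calculus replace an
    integral of complex valued functions. *)
Lemma Re_cexp_derive z w t :
  is_derive t 1 (fun s : R => Rez (z * cexp (w * s%:C)))
    (Rez (z * w * cexp (w * t%:C))).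
Proof.
case: z w => [p q] [a b].
have -> : (fun s : R => Rez ((p +i* q) * cexp ((a +i* b) * s%:C)))
    = (fun s : R => expR (a * s) * (p * cos (b * s) - q * sin (b * s))).
  apply/funext => s; rewrite /cexp !(cReM, cImM) /=.
  by rewrite !(mulr0, mul0r, subr0, add0r, addr0); ring.
apply: is_derive_eq; rewrite /cexp !(cReM, cImM) /=.
rewrite /GRing.scale /= !(mulr0, mul0r, subr0, add0r, addr0, mulr1); ring.
Qed.

End ComplexBasics.

(** * Integrals of continuous functions over a segment *)

Section IntegralBasics.
Variable R : realType.
Implicit Types (f g F : R -> R) (a b t : R).

Definition segint a b f : R := \int[lebesgue_measure]_(t in `[a, b]) f t.

Lemma segint_integrable a b f : continuous f ->
  lebesgue_measure.-integrable `[a, b] (EFin \o f).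
Proof.
move=> cf; apply: continuous_compact_integrable; first exact: segment_compact.
exact: continuous_subspaceT.
Qed.
#[local] Hint Resolve segint_integrable : core.

Lemma segintD a b f g : continuous f -> continuous g ->
  segint a b (fun t => f t + g t) = segint a b f + segint a b g.
Proof. by move=> cf cg; rewrite /segint RintegralD //; exact: segint_integrable. Qed.

Lemma segintZ a b k f : continuous f ->
  segint a b (fun t => k * f t) = k * segint a b f.
Proof. by move=> cf; rewrite /segint RintegralZl //; exact: segint_integrable. Qed.

Lemma eq_segint a b f g : f =1 g -> segint a b f = segint a b g.
Proof. by move=> fg; congr segint; apply/funext. Qed.

Lemma segint_cst a b k : a <= b -> segint a b (fun=> k) = k * (b - a).
Proof.
move=> ab; rewrite /segint Rintegral_cst //= lebesgue_measure_itv /= lte_fin.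
by case: ltgtP ab => // ->; rewrite subrr.
Qed.

Lemma continuous_sum (I : Type) (s : seq I) (f : I -> R -> R) :
  (forall i, continuous (f i)) -> continuous (fun t => \sum_(i <- s) f i t).
Proof.
move=> cf; elim: s => [|i s ih].
  rewrite (_ : (fun _ => _) = cst 0); first exact: cst_continuous.
  by apply/funext => t; rewrite big_nil.
rewrite (_ : (fun _ => _) = f i \+ (fun t => \sum_(i <- s) f i t)).
  by move=> t; apply: continuousD; [exact: cf|exact: ih].
by apply/funext => t; rewrite big_cons.
Qed.

Lemma continuous_scale (k : R) f :
  continuous f -> continuous (fun t => k * f t).
Proof.
by move=> cf t; apply: (@continuousM _ _ (cst k) f); [exact: cst_continuous|exact: cf].
Qed.

Lemma segint_sum (I : Type) (s : seq I) a b (f : I -> R -> R) :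
  (forall i, continuous (f i)) -> a <= b ->
  segint a b (fun t => \sum_(i <- s) f i t) = \sum_(i <- s) segint a b (f i).
Proof.
move=> cf ab; elim: s => [|i s ih].
  rewrite big_nil -[RHS](mul0r (b - a)) -segint_cst //.
  by apply: eq_segint => t; rewrite big_nil.
rewrite big_cons -ih -segintD //; last exact: continuous_sum.
by apply: eq_segint => t; rewrite big_cons.
Qed.

Lemma le_segint a b f g : continuous f -> continuous g ->
  (forall t, a <= t <= b -> f t <= g t) -> segint a b f <= segint a b g.
Proof.
move=> cf cg fg; apply: le_Rintegral => //; try exact: segint_integrable.
Qed.

Lemma segint_ge0 a b f : (forall t, a <= t <= b -> 0 <= f t) -> 0 <= segint a b f.
Proof. by move=> f0; apply: Rintegral_ge0 => t /=; rewrite in_itv /=; exact: f0. Qed.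

Lemma segint_EFin a b f : continuous f ->
  ((segint a b f)%:E = \int[lebesgue_measure]_(t in `[a, b]) (f t)%:E)%E.
Proof.
move=> cf; rewrite /segint /Rintegral fineK //.
by apply: (integrable_fin_num _ (segint_integrable _ _ cf)).
Qed.

(** Monotonicity in the segment is how inequalities on a short interval are
    transferred to a longer one. *)
Lemma segint_widen a b c d f : continuous f ->
  (forall t, c <= t <= d -> 0 <= f t) -> c <= a -> b <= d ->
  segint a b f <= segint c d f.
Proof.
move=> cf f0 ca bd; rewrite -lee_fin !segint_EFin //.
apply: ge0_subset_integral => //.
- by apply/measurable_EFinP; apply: measurable_funTS; exact: continuous_measurable_fun.
- move=> t /=; rewrite !in_itv /= => /andP[h1 h2].
  by rewrite (le_trans ca h1) (le_trans h2 bd).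
Qed.

Lemma is_derive_continuous F f : (forall t, is_derive t 1 F (f t)) ->
  continuous F.
Proof.
move=> dF t; apply: differentiable_continuous; apply/derivable1_diffP.
exact: (@ex_derive _ _ _ _ _ _ _ (dF t)).
Qed.

Lemma segint_FTC a b F f : a <= b -> continuous f ->
  (forall t, is_derive t 1 F (f t)) -> segint a b f = F b - F a.
Proof.
rewrite le_eqVlt => /orP[/eqP<-|ab] cf dF.
  by rewrite /segint set_itv1 Rintegral_set1 subrr.
apply: EFin_inj; rewrite segint_EFin //.
apply: (continuous_FTC2 ab).
- exact: continuous_subspaceT.
- have cF := is_derive_continuous dF.
  split.
  + by move=> t _; exact: (@ex_derive _ _ _ _ _ _ _ (dF t)).
  + by apply: cvg_at_right_filter; exact: cF.
  + by apply: cvg_at_left_filter; exact: cF.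
- by move=> t _; rewrite derive1E; exact: (@derive_val _ _ _ _ _ _ _ (dF t)).
Qed.

End IntegralBasics.

(** * Exponentials against a half period of a sine *)

Section ExponentialIntegrals.
Variable R : realType.
Implicit Types (z w mu : R[i]) (a b t th : R).

Lemma Re_cexp_continuous z w : continuous (fun t : R => Rez (z * cexp (w * t%:C))).
Proof. by apply: is_derive_continuous => t; exact: Re_cexp_derive. Qed.

Lemma segint_Re_cexp a b z w : a <= b ->
  segint a b (fun t => Rez (z * w * cexp (w * t%:C))) =
  Rez (z * (cexp (w * b%:C) - cexp (w * a%:C))).
Proof.
move=> ab; rewrite (segint_FTC ab (@Re_cexp_continuous _ _) (Re_cexp_derive z w)).
by rewrite mulrBr cReD cReN.
Qed.

Lemma sin_weight_derive th a t :
  is_derive t 1 (fun s : R => sin (th * (s - a))) (th * cos (th * (t - a))).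
Proof. by apply: is_derive_eq; rewrite /GRing.scale /=; ring. Qed.

Lemma cos_weight_derive th a t :
  is_derive t 1 (fun s : R => cos (th * (s - a))) (- th * sin (th * (t - a))).
Proof. by apply: is_derive_eq; rewrite /GRing.scale /=; ring. Qed.

Lemma sin_weight_continuous th a : continuous (fun s : R => sin (th * (s - a))).
Proof. by apply: is_derive_continuous => t; exact: sin_weight_derive. Qed.

(** Two integrations by parts reproduce the integrand up to the factor w^2 +
    th^2; multiplying by that factor in advance avoids any division. *)
Lemma sin_cexp_derive th a z w t :
  is_derive t 1 (fun s : R => sin (th * (s - a)) * Rez (z * w * cexp (w * s%:C))
                          + - th * (cos (th * (s - a)) * Rez (z * cexp (w * s%:C))))
    (sin (th * (t - a)) * Rez (z * (w ^+ 2 + (th ^+ 2)%:C) * cexp (w * t%:C))).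
Proof.
have H1 := sin_weight_derive th a t.
have H2 := cos_weight_derive th a t.
have H3 := Re_cexp_derive z w t.
have H4 := Re_cexp_derive (z * w) w t.
apply: is_derive_eq; rewrite /GRing.scale /=.
have -> : z * (w ^+ 2 + (th ^+ 2)%:C) * cexp (w * t%:C) =
    z * w * w * cexp (w * t%:C) + (th ^+ 2)%:C * (z * cexp (w * t%:C)) by ring.
by rewrite cReD cReZ; ring.
Qed.

(** On a half period of the sine both boundary cosines have absolute value 1,
    and the boundary sines vanish. *)
Lemma segint_sin_cexp a b th z w : a <= b -> th * (b - a) = pi ->
  segint a b (fun t => sin (th * (t - a)) *
     Rez (z * (w ^+ 2 + (th ^+ 2)%:C) * cexp (w * t%:C))) =
  th * Rez (z * (cexp (w * a%:C) + cexp (w * b%:C))).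
Proof.
move=> ab thab.
rewrite (segint_FTC ab _ (sin_cexp_derive th a z w)); last first.
  by move=> t; apply: continuousM;
    [exact: sin_weight_continuous|exact: Re_cexp_continuous].
by rewrite thab subrr mulr0 sinpi cospi sin0 cos0 mulrDr cReD; ring.
Qed.

End ExponentialIntegrals.

(** * Finite exponential sums and their energy *)

Section ExponentialSums.
Variables (R : realType) (I : Type).
Implicit Types (mu x : I -> R[i]) (s : seq I) (t : R).

Definition expsum mu s x t : R[i] := \sum_(i <- s) x i * cexp (mu i * t%:C).

(** The squared norm in L2(a, b) of a finite exponential sum. *)
Definition energy a b mu s x : R :=
  segint a b (fun t => normc (expsum mu s x t) ^+ 2).

(** Expanding the square makes every energy a double sum of integrals of
    single exponentials. *)
Lemma sqr_normc_expsum mu s x t : normc (expsum mu s x t) ^+ 2 =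
  \sum_(i <- s) \sum_(j <- s)
    Rez (x i * (x j)^*%C * cexp ((mu i + (mu j)^*%C) * t%:C)).
Proof.
rewrite -Re_mulJ_normc mulrC {1}/expsum mulr_suml Re_sum; apply: eq_bigr => i _.
rewrite /expsum conjc_sum mulr_sumr Re_sum; apply: eq_bigr => j _.
rewrite conjcM -cexp_conj conjcM conjc_real mulrDl cexpD; congr Rez.
by ring.
Qed.

Lemma sqr_normc_expsum_continuous mu s x :
  continuous (fun t => normc (expsum mu s x t) ^+ 2).
Proof.
rewrite (_ : (fun _ => _) = fun t => \sum_(i <- s) \sum_(j <- s)
    Rez (x i * (x j)^*%C * cexp ((mu i + (mu j)^*%C) * t%:C))).
  apply: continuous_sum => i; apply: continuous_sum => j.
  exact: Re_cexp_continuous.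
by apply/funext => t; rewrite sqr_normc_expsum.
Qed.

Lemma energy_ge0 a b mu s x : 0 <= energy a b mu s x.
Proof. by apply: segint_ge0 => t _; rewrite exprn_ge0 ?normc_ge0. Qed.

Lemma energy_widen a b c d mu s x : c <= a -> b <= d ->
  energy a b mu s x <= energy c d mu s x.
Proof.
move=> ca bd; apply: segint_widen => //; first exact: sqr_normc_expsum_continuous.
by move=> t _; rewrite exprn_ge0 ?normc_ge0.
Qed.

End ExponentialSums.

(** * Schur's test *)

Section Schur.
Variable R : realType.

(** Duplicate free lists are compared by inclusion, which replaces sums over
    sets of indices. *)
Lemma ler_uniq_sum (T : eqType) (t r : seq T) (F : T -> R) :
  uniq t -> uniq r -> {subset t <= r} -> (forall i, 0 <= F i) ->
  \sum_(i <- t) F i <= \sum_(i <- r) F i.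
Proof.
move=> ut ur sub F0.
have E : perm_eq t [seq i <- r | i \in t].
  apply: uniq_perm => //; first exact: filter_uniq.
  move=> i; rewrite mem_filter; case: (boolP (i \in t)) => //= /sub ->//.
rewrite (perm_big _ E) big_filter [leLHS]big_mkcond.
by apply: ler_sum => i _; case: ifP.
Qed.

(** Bound u_i u_j by (u_i^2 + u_j^2) / 2 and use the symmetry of A: each half
    of the sum is a sum of row sums. *)
Lemma schur_test (T : eqType) (s : seq T) (A : T -> T -> R) (B : R) (u : T -> R) :
  (forall i j, A i j = A j i) ->
  (forall i j, i \in s -> j \in s -> i != j -> 0 <= A i j) ->
  (forall i, i \in s -> \sum_(j <- s | j != i) A i j <= B) ->
  \sum_(i <- s) \sum_(j <- s | j != i) A i j * (u i * u j) <=
  B * \sum_(i <- s) u i ^+ 2.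
Proof.
move=> Asym A0 AB.
pose S := \sum_(i <- s) \sum_(j <- s | j != i) A i j * u i ^+ 2.
have SB : S <= B * \sum_(i <- s) u i ^+ 2.
  rewrite mulr_sumr /S big_seq [leRHS]big_seq; apply: ler_sum => i si.
  by rewrite -mulr_suml ler_wpM2r ?sqr_ge0 ?AB.
have SE : S = \sum_(i <- s) \sum_(j <- s | j != i) A i j * u j ^+ 2.
  rewrite /S (exchange_big_dep xpredT) //=; apply: eq_bigr => i _.
  by apply: eq_big => [j|j _]; rewrite 1?eq_sym // Asym.
apply: le_trans SB.
have -> : S = 2^-1 * (S + S) by field.
rewrite {2}SE /S -big_split mulr_sumr big_seq [leRHS]big_seq.
apply: ler_sum => i si; rewrite -big_split mulr_sumr /=.
rewrite big_seq_cond [leRHS]big_seq_cond.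
apply: ler_sum => j /andP[sj ji].
have A0' : 0 <= A i j by apply: A0; rewrite // eq_sym.
rewrite -mulrDr [leRHS]mulrCA; apply: ler_wpM2l => //.
rewrite -subr_ge0 [X in 0 <= X](_ : _ = 2^-1 * (u i - u j) ^+ 2); last by field.
by rewrite mulr_ge0 ?sqr_ge0.
Qed.

(** The term is 1 / (m + 1/2) - 1 / (m + 3/2). *)
Lemma telescoping_sum_le2 (t : seq nat) : uniq t ->
  \sum_(m <- t) ((m%:R + 1) ^+ 2 - 4^-1 : R)^-1 <= 2.
Proof.
move=> ut; pose N := (\max_(m <- t) m).+1.
have sub : {subset t <= iota 0 N}.
  by move=> m mt; rewrite mem_iota /= add0n ltnS; exact: leq_bigmax_seq.
have pos m : 0 < (m%:R + 1) ^+ 2 - 4^-1 :> R by have := ler0n R m; nra.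
apply: (le_trans (ler_uniq_sum ut (iota_uniq 0 N) sub _)).
  by move=> m; rewrite invr_ge0 ltW.
have -> : iota 0 N = index_iota 0 N by rewrite /index_iota subn0.
have -> n : \sum_(0 <= m < n) ((m%:R + 1) ^+ 2 - 4^-1 : R)^-1 =
    2 - (n%:R + 2^-1)^-1.
  elim: n => [|n ih]; first by rewrite big_geq // add0r invrK subrr.
  rewrite big_nat_recr //= ih -natr1.
  have n0 := ler0n R n; have := pos n.
  move=> p; field; apply/and3P; split; apply/lt0r_neq0; nra.
by rewrite lerBlDr lerDl invr_ge0 addr_ge0.
Qed.

(** The two sides j < i and j > i contribute at most 2 each. The value 4 is
    what determines the critical time. *)
Lemma row_sum_le4 (s : seq int) (i : int) : uniq s ->
  \sum_(j <- s | j != i) (((i - j)%:~R) ^+ 2 - 4^-1 : R)^-1 <= 4.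
Proof.
move=> us.
pose F (m : nat) := ((m%:R + 1) ^+ 2 - 4^-1 : R)^-1.
have absE j : j != i -> ((i - j)%:~R ^+ 2 - 4^-1 : R)^-1 = F `|(i - j)%R|%N.-1.
  move=> ji; rewrite /F natr1 prednK; last by rewrite absz_gt0 subr_eq0 eq_sym.
  by congr ((_ - _)^-1); rewrite natr_absz intr_norm real_normK ?num_real.
rewrite (eq_bigr (fun j => F `|(i - j)%R|%N.-1)); last by move=> j /absE.
rewrite (bigID (fun j => j < i)) /= (_ : 4 = 2 + 2); last by ring.
apply: lerD; rewrite -big_filter -(big_map (fun j => `|(i - j)%R|%N.-1) xpredT F).
  apply: telescoping_sum_le2; rewrite map_inj_in_uniq ?filter_uniq //.
  by move=> j k; rewrite !mem_filter => /andP[/andP[_ h1] _] /andP[/andP[_ h2] _]; lia.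
apply: telescoping_sum_le2; rewrite map_inj_in_uniq ?filter_uniq //.
by move=> j k; rewrite !mem_filter => /andP[/andP[h0 h1] _] /andP[/andP[h00 h2] _]; lia.
Qed.

End Schur.

(** * Ingham's estimate for separated frequencies *)

Section Kernel.
Variable R : realType.
Implicit Types (z w : R[i]).

Lemma segint_sin_Re_cexp lo hi th z w : lo <= hi -> th * (hi - lo) = pi ->
  w ^+ 2 + (th ^+ 2)%:C != 0 ->
  segint lo hi (fun t => sin (th * (t - lo)) * Rez (z * cexp (w * t%:C))) =
  th * Rez (z / (w ^+ 2 + (th ^+ 2)%:C) *
            (cexp (w * lo%:C) + cexp (w * hi%:C))).
Proof.
move=> lohi thE d0; rewrite -segint_sin_cexp //.
by apply: eq_segint => t; rewrite mulfVK.
Qed.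

Lemma Re_mulr_real z (t : R) : Rez (z * t%:C) = Rez z * t.
Proof. by rewrite mulrC cReZ mulrC. Qed.

(** The kernel is th (e^(w lo) + e^(w hi)) / (w^2 + th^2), and the real part
    of the denominator is already at most - D. *)
Lemma kernel_entry_le lo hi th z w D : lo <= hi -> th * (hi - lo) = pi ->
  0 <= th -> 0 < D -> D <= Imz w ^+ 2 - Rez w ^+ 2 - th ^+ 2 ->
  `|segint lo hi (fun t => sin (th * (t - lo)) * Rez (z * cexp (w * t%:C)))| <=
  th / D * normc z * (expR (Rez w * lo) + expR (Rez w * hi)).
Proof.
move=> lohi thE th0 D0 Dle.
set d := w ^+ 2 + (th ^+ 2)%:C.
have Dd : D <= normc d.
  apply: (le_trans _ (Re_le_normc d)); apply: (le_trans Dle).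
  rewrite -normrN; apply: (le_trans _ (ler_norm _)).
  by rewrite /d cReD expr2 cReM /= -!expr2; lra.
have d0 : d != 0.
  by apply: contraTneq Dd => ->; rewrite Normc.normc0 -ltNge.
rewrite segint_sin_Re_cexp // normrM (ger0_norm th0).
rewrite (_ : th / D * _ * _ = th * (D^-1 * normc z *
  (expR (Rez w * lo) + expR (Rez w * hi)))); last by ring.
apply: ler_wpM2l => //; apply: (le_trans (Re_le_normc _)).
rewrite Normc.normcM; apply: ler_pM; rewrite ?normc_ge0 //.
  rewrite Normc.normcM Normc.normcV mulrC; apply: ler_wpM2r; first exact: normc_ge0.
  by rewrite lef_pV2 ?posrE // (lt_le_trans D0).
by apply: (le_trans (le_normcD _ _)); rewrite !normc_cexp !Re_mulr_real.
Qed.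

Lemma kernel_diag lo hi th (b : R) z : lo <= hi -> th * (hi - lo) = pi ->
  0 < th ->
  segint lo hi (fun t => sin (th * (t - lo)) *
     Rez (z * z^*%C * cexp ((- (2 * b))%:C * t%:C))) =
  th * (expR (- 2 * b * lo) + expR (- 2 * b * hi)) / (4 * b ^+ 2 + th ^+ 2)
   * normc z ^+ 2.
Proof.
move=> lohi thE th0.
have p0 : 0 < 4 * b ^+ 2 + th ^+ 2.
  by rewrite ltr_wpDl ?exprn_gt0 // mulr_ge0 ?sqr_ge0.
have dE : (- (2 * b))%:C ^+ 2 + (th ^+ 2)%:C = (4 * b ^+ 2 + th ^+ 2)%:C.
  rewrite -rmorphXn -rmorphD; congr (_%:C); ring.
rewrite segint_sin_Re_cexp // dE; last first.
  by apply/negP => /eqP/complexI h; move: p0; rewrite h ltxx.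
rewrite -!rmorphM !cexp_real -fmorphV -rmorphD /= !Re_mulr_real (mulrC z) Re_mulJ_normc.
by rewrite !mulNr; ring.
Qed.

End Kernel.

Section InghamSine.
Variable R : realType.

(** Since 4 beta^2 + th^2 <= g^2 / 4, the denominator of the entry (i, j) of
    the kernel is at least g^2 ((i - j)^2 - 1/4), and the row sums of the
    inverses are at most 4 / g^2. The numerator e^(- (b i + b j) lo) + e^(- (b
    i + b j) hi) splits into two products, so that Schur's test is applied
    once at each endpoint, to the coefficients weighted by e^(- b i lo) and by
    e^(- b i hi); the weights of the diagonal come out exactly and the growth
    of the exponentials costs nothing. *)
Lemma ingham_sine (a b : int -> R) (g beta th lo hi : R) (s : seq int)
    (x : int -> R[i]) :
  uniq s -> 0 < th -> lo <= hi -> th * (hi - lo) = pi -> 0 < g ->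
  (forall i, i \in s -> 0 <= b i <= beta) ->
  (forall i j, i \in s -> j \in s -> g * `|(i - j)%:~R| <= `|a i - a j|) ->
  4 * beta ^+ 2 + th ^+ 2 <= g ^+ 2 / 4 ->
  let mu i := - b i +i* a i in
  let E i := expR (- 2 * b i * lo) + expR (- 2 * b i * hi) in
  is_true (`|segint lo hi
      (fun t => sin (th * (t - lo)) * normc (expsum mu s x t) ^+ 2)
    - \sum_(i <- s) th * E i / (4 * b i ^+ 2 + th ^+ 2) * normc (x i) ^+ 2| <=
  4 * th / g ^+ 2 * \sum_(i <- s) E i * normc (x i) ^+ 2).
Proof.
move=> us th0 lohi thE g0 hb hg hq mu E.
pose T i j := segint lo hi (fun t => sin (th * (t - lo)) *
  Rez (x i * (x j)^*%C * cexp ((mu i + (mu j)^*%C) * t%:C))).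
have cT i j : continuous (fun t : R => sin (th * (t - lo)) *
  Rez (x i * (x j)^*%C * cexp ((mu i + (mu j)^*%C) * t%:C))).
  by move=> t; apply: continuousM;
    [exact: sin_weight_continuous|exact: Re_cexp_continuous].
have -> : segint lo hi
    (fun t => sin (th * (t - lo)) * normc (expsum mu s x t) ^+ 2) =
    \sum_(i <- s) \sum_(j <- s) T i j.
  under eq_bigr do rewrite -segint_sum //.
  rewrite -segint_sum //; last by move=> i; exact: continuous_sum.
  apply: eq_segint => t; rewrite sqr_normc_expsum mulr_sumr.
  by apply: eq_bigr => i _; rewrite mulr_sumr.
have TD i : T i i = th * E i / (4 * b i ^+ 2 + th ^+ 2) * normc (x i) ^+ 2.
  rewrite /E -(kernel_diag (b i) (x i) lohi thE th0) /T; apply: eq_segint => t.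
  rewrite (_ : mu i + (mu i)^*%C = (- (2 * b i))%:C) //.
  by apply/eqP; rewrite eq_complex /mu /=; apply/andP; split; apply/eqP; ring.
have -> : \sum_(i <- s) \sum_(j <- s) T i j -
    \sum_(i <- s) th * E i / (4 * b i ^+ 2 + th ^+ 2) * normc (x i) ^+ 2 =
    \sum_(i <- s) \sum_(j <- s | j != i) T i j.
  rewrite -sumrB big_seq [RHS]big_seq; apply: eq_bigr => i si.
  by rewrite (bigD1_seq i) //= -TD addrAC subrr add0r.
pose A (i j : int) : R := ((i - j)%:~R ^+ 2 - 4^-1)^-1.
pose u e i := expR (- b i * e) * normc (x i).
have Apos i j : i != j -> 0 < (i - j)%:~R ^+ 2 - 4^-1 :> R.
  move=> ij; have : 1 <= `|(i - j)%:~R : R|.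
    rewrite -intr_norm ler1z; lia.
  by rewrite -real_normK ?num_real //; nra.
have A0 i j : i \in s -> j \in s -> i != j -> 0 <= A i j.
  by move=> _ _ ij; rewrite invr_ge0 ltW // Apos.
have Asym i j : A i j = A j i by rewrite /A -(opprB j i) mulrNz sqrrN.
have Arow i : i \in s -> \sum_(j <- s | j != i) A i j <= 4.
  by move=> _; exact: row_sum_le4.
have Tle i j : i \in s -> j \in s -> j != i ->
    `|T i j| <= th / g ^+ 2 *
      (A i j * (u lo i * u lo j) + A i j * (u hi i * u hi j)).
  move=> si sj ji; have ij : i != j by rewrite eq_sym.
  have Ap := Apos _ _ ij.
  have Dp : 0 < g ^+ 2 * ((i - j)%:~R ^+ 2 - 4^-1).
    by rewrite mulr_gt0 ?exprn_gt0.
  have h := hg _ _ si sj.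
  apply: le_trans (kernel_entry_le _ lohi thE (ltW th0) Dp _) _.
    rewrite cReD cReJ cImD cImJ /=.
    have : (g * `|(i - j)%:~R|) ^+ 2 <= `|a i - a j| ^+ 2.
      by rewrite ler_pXn2r ?nnegrE ?mulr_ge0 // ltW.
    rewrite exprMn !real_normK ?num_real // => h2.
    have /andP[bi0 bib] := hb _ si; have /andP[bj0 bjb] := hb _ sj.
    nra.
  rewrite cReD cReJ /= Normc.normcM normc_conj.
  have expE e : expR ((- b i - b j) * e) = expR (- b i * e) * expR (- b j * e).
    by rewrite -expRD; congr expR; ring.
  rewrite !expE invfM /u /A le_eqVlt; apply/orP; left; apply/eqP; ring.
have Sle e : \sum_(i <- s) \sum_(j <- s | j != i) A i j * (u e i * u e j) <=
    4 * \sum_(i <- s) u e i ^+ 2 by exact: schur_test.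
apply: le_trans (ler_norm_sum _ _ _) _.
apply: (@le_trans _ _ (\sum_(i <- s) \sum_(j <- s | j != i) (th / g ^+ 2 *
      (A i j * (u lo i * u lo j) + A i j * (u hi i * u hi j))))).
  rewrite big_seq [leRHS]big_seq; apply: ler_sum => i si.
  apply: le_trans (ler_norm_sum _ _ _) _.
  rewrite big_seq_cond [leRHS]big_seq_cond; apply: ler_sum => j /andP[sj ji].
  exact: Tle.
under eq_bigr do rewrite -mulr_sumr big_split /=.
rewrite -mulr_sumr big_split /=.
have -> : 4 * th / g ^+ 2 * \sum_(i <- s) E i * normc (x i) ^+ 2 =
    th / g ^+ 2 *
    (4 * \sum_(i <- s) u lo i ^+ 2 + 4 * \sum_(i <- s) u hi i ^+ 2).
  rewrite -mulrDr -big_split /= mulrA (mulrC _ 4) !mulrA; congr (_ * _).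
  apply: eq_bigr => i _; rewrite /u /E !exprMn -!expRM_natl mulrDl.
  by congr (expR _ * _ + expR _ * _); ring.
apply: ler_wpM2l; first by rewrite divr_ge0 ?sqr_ge0 ?ltW.
by apply: lerD; exact: Sle.
Qed.
End InghamSine.

(** * Direct and inverse inequalities *)

Section FrameInequalities.
Variables (R : realType) (I : eqType).
Implicit Types (mu x : I -> R[i]) (D : pred I) (s : seq I).

(** The constant depends on the exponents mu, on the set D of admissible
    indices and on T, but not on the length of the sum. *)
Definition inverse_inequality mu D T :=
  exists2 K : R, 0 < K & forall s x, uniq s -> all D s ->
    \sum_(i <- s) normc (x i) ^+ 2 <= K * energy 0 T mu s x.

Definition direct_inequality mu D T :=
  exists2 K : R, 0 < K & forall s x, uniq s -> all D s ->
    energy 0 T mu s x <= K * \sum_(i <- s) normc (x i) ^+ 2.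

End FrameInequalities.

(** The cosine is even and decreasing on [0, pi]. *)
Lemma ler_cos_norm (R : realType) (B t : R) :
  `|t| <= B -> B <= pi -> cos B <= cos t.
Proof.
move=> tB Bpi.
have iB : B \in `[0, pi : R] by rewrite in_itv /= Bpi (le_trans _ tB).
have it : `|t| \in `[0, pi : R].
  by rewrite in_itv /= normr_ge0 (le_trans tB).
by rewrite -(cos_norm t) leNgt ltr_cos // -leNgt.
Qed.

Section Tail.
Variable R : realType.
Variables (a b : int -> R) (D : pred int) (g beta : R).
Hypothesis g0 : 0 < g.
Hypothesis hb : forall i, D i -> 0 <= b i <= beta.
Hypothesis hg : forall i j, D i -> D j -> g * `|(i - j)%:~R| <= `|a i - a j|.

Let mu i := - b i +i* a i.

Let weighted_continuous (th lo : R) (s : seq int) (x : int -> R[i]) :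
  continuous (fun t : R => sin (th * (t - lo)) * normc (expsum mu s x t) ^+ 2).
Proof.
move=> t; apply: (@continuousM _ _ (fun t => sin (th * (t - lo)))
  (fun t => normc (expsum mu s x t) ^+ 2)); first exact: sin_weight_continuous.
exact: sqr_normc_expsum_continuous.
Qed.

Lemma quad_gt0 (u th : R) : 0 < th -> 0 < 4 * u ^+ 2 + th ^+ 2.
Proof. by move=> th0; rewrite ltr_wpDl ?exprn_gt0 // mulr_ge0 ?sqr_ge0. Qed.

(** The sine is at most 1, and on the diagonal th / (4 b^2 + th^2) exceeds 4
    th / g^2, which is all that the rest of the kernel can take away. *)
Lemma inverse_inequality_tail (T : R) : 0 < T ->
  4 * beta ^+ 2 + (pi / T) ^+ 2 < g ^+ 2 / 4 -> inverse_inequality mu D T.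
Proof.
move=> T0 hq; set th := pi / T.
have th0 : 0 < th by rewrite divr_gt0 ?pi_gt0.
pose q := 4 * beta ^+ 2 + th ^+ 2.
have q0 : 0 < q by exact: quad_gt0.
pose kap := th * (q^-1 - 4 / g ^+ 2).
have kap0 : 0 < kap.
  rewrite mulr_gt0 // subr_gt0 -invf_div ltf_pV2 // posrE divr_gt0 ?exprn_gt0 //.
exists kap^-1; first by rewrite invr_gt0.
move=> s x us /allP sD.
rewrite ler_pdivlMl // mulr_sumr.
have thE : th * (T - 0) = pi by rewrite subr0 /th divfK ?lt0r_neq0.
have := ingham_sine x us th0 (ltW T0) thE g0 (fun i si => hb (sD i si))
  (fun i j si sj => hg (sD i si) (sD j sj)) (ltW hq).
move=> /=; set S := segint _ _ _ => hI.
have Sle : S <= energy 0 T mu s x.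
  apply: le_segint; first exact: weighted_continuous.
    exact: sqr_normc_expsum_continuous.
  by move=> t _; rewrite ler_piMl ?sqr_ge0 // sin_le1.
apply: le_trans Sle; move: hI; rewrite ler_norml => /andP[hI _].
rewrite lerBrDl in hI.
apply: le_trans hI; rewrite mulr_sumr -sumrB.
rewrite big_seq [leRHS]big_seq; apply: ler_sum => i si.
have /andP[bi0 bib] := hb (sD i si).
rewrite mulr0 expR0.
set E := 1 + expR _; set n := normc _ ^+ 2.
have n0 : 0 <= n by rewrite sqr_ge0.
have E1 : 1 <= E by rewrite lerDl expR_ge0.
rewrite (_ : th * E / _ * n - 4 * th / g ^+ 2 * (E * n) =
  th * ((4 * b i ^+ 2 + th ^+ 2)^-1 - 4 / g ^+ 2) * (E * n)); last by ring.
apply: (@le_trans _ _ (kap * (E * n))).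
  by rewrite ler_pM2l // ler_peMl.
apply: ler_wpM2r; first by rewrite mulr_ge0 // (le_trans ler01).
rewrite ler_pM2l // lerD2r lef_pV2 ?posrE //; last first.
  exact: quad_gt0.
by rewrite lerD2r ler_pM2l // ler_pXn2r ?nnegrE // (le_trans bi0).
Qed.

(** The sine of a longer half period is bounded below by cos 1 on [0, T]. A
    long half period has a small th, for which the hypothesis of ingham_sine
    follows from 4 beta^2 < g^2 / 4; here the diagonal only has to be bounded
    above. *)
Lemma direct_inequality_tail (T : R) : 0 < T -> 4 * beta ^+ 2 < g ^+ 2 / 4 ->
  direct_inequality mu D T.
Proof.
move=> T0 hq.
pose th := Num.min (2 / T) (Num.sqrt (g ^+ 2 / 4 - 4 * beta ^+ 2)).
have th0 : 0 < th by rewrite lt_min divr_gt0 // sqrtr_gt0 subr_gt0.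
have thT : th * T / 2 <= 1.
  by rewrite -mulrA -ler_pdivlMr ?divr_gt0 // div1r invf_div ge_min lexx.
have hth : 4 * beta ^+ 2 + th ^+ 2 <= g ^+ 2 / 4.
  rewrite -lerBrDl -[leRHS]sqr_sqrtr ?subr_ge0 ?(ltW hq) //.
  by rewrite ler_pXn2r ?nnegrE ?sqrtr_ge0 ?(ltW th0) // ge_min lexx orbT.
(* The half period is centred at T / 2, and th T / 2 <= 1 on [0, T]. *)
pose lo := T / 2 - pi / (2 * th); pose hi := T / 2 + pi / (2 * th).
have thE : th * (hi - lo) = pi by rewrite /hi /lo; field; exact: lt0r_neq0.
have pi2 := pi_ge2 R.
have Tle : T / 2 <= pi / (2 * th).
  rewrite ler_pdivlMr ?mulr_gt0 //; lra.
have lo0 : lo <= 0 by rewrite subr_le0.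
have hiT : T <= hi by rewrite /hi; lra.
have lohi : lo <= hi by rewrite (le_trans lo0) // (le_trans (ltW T0)).
have c1 := cos1_gt0 R.
have sin_low t : 0 <= t <= T -> cos 1 <= sin (th * (t - lo)).
  move=> /andP[t0 tT].
  have -> : th * (t - lo) = th * (t - T / 2) + pi / 2.
    by rewrite /lo; field; exact: lt0r_neq0.
  rewrite sinDpihalf; apply: ler_cos_norm; last by lra.
  rewrite normrM gtr0_norm //; apply: le_trans thT.
  by rewrite -mulrA ler_pM2l // ler_norml; apply/andP; split; lra.
have sin_pos t : lo <= t <= hi -> 0 <= sin (th * (t - lo)).
  move=> /andP[t0 tT]; apply: sin_ge0_pi.
  by rewrite mulr_ge0 ?subr_ge0 ?(ltW th0) //= -thE ler_pM2l // lerD2r.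
pose Em := expR (- 2 * beta * lo) + 1.
have Em0 : 0 < Em by rewrite addr_gt0 ?expR_gt0.
pose B := (cos 1)^-1 * ((th^-1 + 4 * th / g ^+ 2) * Em).
have B0 : 0 < B.
  rewrite mulr_gt0 ?invr_gt0 // mulr_gt0 // addr_gt0 ?invr_gt0 //.
  by rewrite divr_gt0 ?exprn_gt0 ?mulr_gt0.
exists B => // s x us /allP sD.
have := ingham_sine x us th0 lohi thE g0 (fun i si => hb (sD i si))
  (fun i j si sj => hg (sD i si) (sD j sj)) hth.
move=> /=; set S := segint _ _ _ => hI.
have Sle : energy 0 T mu s x <= (cos 1)^-1 * S.
  rewrite ler_pdivlMl //.
  apply: (@le_trans _ _ (segint 0 T
      (fun t => sin (th * (t - lo)) * normc (expsum mu s x t) ^+ 2))).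
    rewrite -segintZ; last exact: sqr_normc_expsum_continuous.
    apply: le_segint.
    - by apply: continuous_scale; exact: sqr_normc_expsum_continuous.
    - exact: weighted_continuous.
    - by move=> t tT; rewrite ler_wpM2r ?sqr_ge0 // sin_low.
  apply: segint_widen => //.
  by move=> t tT; rewrite mulr_ge0 ?sqr_ge0 // sin_pos.
apply: (le_trans Sle); rewrite /B -!mulrA ler_pM2l ?invr_gt0 //.
move: hI; rewrite ler_norml => /andP[_]; rewrite lerBlDl => hI.
apply: (le_trans hI); rewrite !mulr_sumr -big_split.
rewrite big_seq [leRHS]big_seq; apply: ler_sum => i si /=.
have /andP[bi0 bib] := hb (sD i si).
set E := expR _ + expR _; set n := normc _ ^+ 2.
have n0 : 0 <= n by rewrite sqr_ge0.
have E0 : 0 <= E by rewrite addr_ge0 ?expR_ge0.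
have EEm : E <= Em.
  apply: lerD; rewrite ?ler_expR.
    by rewrite !mulNr lerN2; nra.
  rewrite -[leRHS]expR0 ler_expR; have := le_trans (ltW T0) hiT; nra.
rewrite (_ : _ + _ =
  (th / (4 * b i ^+ 2 + th ^+ 2) + 4 * th / g ^+ 2) * E * n); last by ring.
rewrite [leRHS]mulrA; apply: ler_wpM2r => //.
apply: ler_pM => //; 
  first by apply: addr_ge0; apply: divr_ge0;
    rewrite ?sqr_ge0 ?mulr_ge0 ?(ltW th0) ?(ltW (quad_gt0 _ th0)).
rewrite (mulrA 4) lerD2r ler_pdivrMr; last exact: quad_gt0.
rewrite mulrDr expr2 mulKf ?lt0r_neq0 // lerDr.
by rewrite mulr_ge0 ?invr_ge0 ?(ltW th0) // mulr_ge0 ?sqr_ge0.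
Qed.

End Tail.

(** * Lower bounds for the multiplier 1 - (e^w - 1) / w *)

Section Multiplier.
Variable R : realType.
Implicit Types (z w : R[i]).

(** The mean of e^(s w) over 0 <= s <= 1. *)
Definition cexp_mean w : R[i] := if w == 0 then 1 else (cexp w - 1) / w.

Lemma is_derive_ge0_le (F f : R -> R) (b : R) : 0 <= b ->
  (forall t : R, is_derive t 1 F (f t)) ->
  (forall t : R, 0 <= t <= b -> 0 <= f t) ->
  F 0 <= F b.
Proof.
move=> b0 dF f0.
have [|t tb E] := @MVT_segment R F f 0 b b0 (fun t _ => dF t).
  by apply: continuous_subspaceT; exact: is_derive_continuous dF.
by rewrite -subr_ge0 E subr0 mulr_ge0 // f0.
Qed.

(** By Taylor's formula e^w - 1 - w is w^2 times the integral over [0, 1] of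
    (1 - s) e^(s w). After multiplication by the conjugate of w^2 the real
    part has second derivative |w|^4 Re e^(s w) >= k |w|^4, and two
    integrations give k |w|^4 / 2. *)
Lemma cexp_remainder_ge (k : R) w :
  (forall t : R, 0 <= t <= 1 -> k <= Rez (cexp (w * t%:C))) ->
  k / 2 * normc w ^+ 2 <= normc (cexp w - 1 - w).
Proof.
move=> hk; set n := normc w.
have [w0|w0] := eqVneq w 0.
  by rewrite /n w0 Normc.normc0 expr0n mulr0 normc_ge0.
have n0 : 0 < n by exact: normc_gt0.
pose v := (w ^+ 2)^*%C.
have vw : v * w * w = (n ^+ 4)%:C.
  have e : w^*%C * w = (n ^+ 2)%:C.
    apply/eqP; rewrite eq_complex Re_mulJ_normc eqxx /= cImM cReJ cImJ.
    by apply/eqP; ring.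
  by rewrite /v expr2 conjcM (_ : _ * w * w = (w^*%C * w) * (w^*%C * w));
    [rewrite e -rmorphM -exprD|ring].
have nv : normc v = n ^+ 2 by rewrite normc_conj expr2 Normc.normcM expr2.
have dlin z : forall t : R, is_derive t 1 (fun s : R => Rez (z * s%:C)) (Rez z).
  move=> t; rewrite (_ : (fun s => _) = (fun s : R => Rez z * s)).
    by apply: is_derive_eq; rewrite /GRing.scale /= mulr1.
  by apply/funext => s; rewrite mulrC cReZ mulrC.
have d1 t : 0 <= t <= 1 ->
    k * n ^+ 4 * t <= Rez (v * w * cexp (w * t%:C)) - Rez (v * w).
  move=> /andP[t0 t1].
  pose F (s : R) := Rez (v * w * cexp (w * s%:C)) - k * n ^+ 4 * s.
  have dF (s : R) : is_derive s 1 F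
      (Rez (v * w * w * cexp (w * s%:C)) - k * n ^+ 4).
    have H := Re_cexp_derive (v * w) w s.
    by apply: is_derive_eq; rewrite /GRing.scale /= mulr1.
  have F0 : F 0 = Rez (v * w).
    by rewrite /F rmorph0 !mulr0 cexp0 mulr1 subr0.
  suff : F 0 <= F t by rewrite F0 /F => h; lra.
  apply: is_derive_ge0_le dF _ => // s /andP[s0 st].
  rewrite vw cReZ mulrC -mulrBl mulr_ge0 ?exprn_ge0 ?(ltW n0) // subr_ge0 hk //.
  by rewrite s0 (le_trans st).
pose G (s : R) := Rez (v * cexp (w * s%:C)) - Rez (v * w * s%:C)
                   - k * n ^+ 4 / 2 * s ^+ 2.
have dG (s : R) : is_derive s 1 G (Rez (v * w * cexp (w * s%:C)) - Rez (v * w)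
                    - k * n ^+ 4 * s).
  have H := Re_cexp_derive v w s.
  have H' := dlin (v * w) s.
  by apply: is_derive_eq; rewrite /GRing.scale /=; field.
have hG : G 0 <= G 1.
  by apply: is_derive_ge0_le dG _ => // t t01; rewrite subr_ge0 d1.
move: hG; rewrite /G rmorph0 !mulr0 rmorph1 !mulr1 cexp0 mulr1.
rewrite expr0n expr1n mulr0 mulr1 => hG.
have {hG} : k * n ^+ 4 / 2 <= Rez (v * (cexp w - 1 - w)).
  move: hG; rewrite !mulrDr !mulrN !cReD !cReN mulr1 /= subr0 => hG.
  by lra.
move=> /le_trans/(_ (ler_norm _))/le_trans/(_ (Re_le_normc _)).
rewrite Normc.normcM nv => h.
rewrite -(ler_pM2l (exprn_gt0 2 n0)); apply: le_trans h.
by rewrite le_eqVlt; apply/orP; left; apply/eqP; field.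
Qed.

(** For |Im w| <= B < pi / 2 the real part of e^(s w) stays positive and
    Taylor's formula applies. For |Im w| >= B > 1 the imaginary part of the
    remainder is at least |Im w| - e^(Re w), which is comparable to |w| when
    Re w is small. The two cases cover everything because 1 < pi / 2. *)
Lemma cexp_remainder_lower : exists eps c0 : R, [/\ 0 < eps, 0 < c0 &
  forall w, `|Rez w| <= eps ->
    c0 * Num.min 1 (normc w) * normc w <= normc (cexp w - 1 - w)].
Proof.
(* B is any number strictly between 1 and pi / 2. *)
pose B : R := (1 + pi / 2) / 2.
have pi2 : 1 < pi / 2 :> R.
  rewrite lt_neqAle pihalf_ge1 andbT; apply/eqP => e.
  by have := cos1_gt0 R; rewrite e cos_pihalf ltxx.
have B1 : 1 < B by rewrite /B; lra.
have Bpi : B < pi / 2 by rewrite /B; lra.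
have cB : 0 < cos B by apply: cos_gt0_pihalf; lra.
pose k : R := expR (- 1) * cos B.
have k0 : 0 < k by rewrite mulr_gt0 ?expR_gt0.
pose eps : R := Num.min 1 (ln ((1 + B) / 2)).
have l0 : 0 < ln ((1 + B) / 2) by apply: ln_gt0; lra.
have eps0 : 0 < eps by rewrite lt_min ltr01.
pose c0 : R := Num.min (k / 2) ((B - 1) / (4 * B)).
have c00 : 0 < c0.
  by rewrite /c0 lt_min; apply/andP; split; apply: divr_gt0; lra.
exists eps, c0; split => // w rw.
have rw1 : `|Rez w| <= 1 by rewrite (le_trans rw) // ge_min lexx.
have n0 := normc_ge0 w.
have [iw|iw] := leP `|Imz w| B.
  have hk t : 0 <= t <= 1 -> k <= Rez (cexp (w * t%:C)).
    move=> /andP[t0 t1]; rewrite Re_cexp (mulrC w) cReZ cImZ.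
    apply: ler_pM; rewrite ?expR_ge0 ?(ltW cB) //.
      by rewrite ler_expR; move: rw1; rewrite ler_norml; nra.
    apply: ler_cos_norm; last by lra.
    by rewrite normrM (ger0_norm t0) (le_trans _ iw) // ler_piMl.
  apply: le_trans (cexp_remainder_ge hk).
  rewrite expr2 mulrA; apply: ler_wpM2r => //.
  apply: ler_pM; rewrite ?(ltW c00) // ?le_min ?ler01 // ?ge_min ?lexx ?orbT //.
apply: (le_trans _ (Im_le_normc _)).
rewrite !cImD !cImN Im_cexp [Imz 1]/= oppr0 addr0.
have eR : expR (Rez w) <= (1 + B) / 2.
  rewrite -[leRHS]lnK ?posrE; last by lra.
  rewrite ler_expR (le_trans (ler_norm _)) // (le_trans rw) //.
  by rewrite ge_min lexx orbT.
have sm := sin_max (Imz w).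
apply: (@le_trans _ _ (`|Imz w| - (1 + B) / 2)); last first.
  rewrite distrC; apply: (le_trans _ (lerB_dist _ _)); rewrite lerD2l lerN2.
  rewrite normrM (gtr0_norm (expR_gt0 _)).
  by rewrite -[leRHS]mulr1; apply: ler_pM => //; rewrite expR_ge0.
have nle : normc w <= 2 * `|Imz w|.
  have : normc w <= `|Rez w| + `|Imz w|.
    rewrite -ler_sqr ?nnegrE ?addr_ge0 // normc_sqr.
    rewrite -(real_normK (num_real (Rez w))) -(real_normK (num_real (Imz w))).
    have := normr_ge0 (Rez w); have := normr_ge0 (Imz w); nra.
  by lra.
apply: (@le_trans _ _ ((B - 1) / (4 * B) * (2 * `|Imz w|))).
  apply: ler_pM => //; first by rewrite mulr_ge0 ?(ltW c00) // le_min ler01.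
  rewrite -[leRHS]mulr1; apply: ler_pM; rewrite ?(ltW c00) // ?le_min ?ler01 //.
    by rewrite ge_min lexx orbT.
  by rewrite ge_min lexx.
rewrite (_ : _ * (2 * _) = (B - 1) / (2 * B) * `|Imz w|); last first.
  by field; rewrite lt0r_neq0 // (lt_trans ltr01).
rewrite -subr_ge0.
have -> : `|Imz w| - (1 + B) / 2 - (B - 1) / (2 * B) * `|Imz w| =
    (B + 1) / (2 * B) * (`|Imz w| - B).
  by field; rewrite lt0r_neq0 // (lt_trans ltr01).
by rewrite mulr_ge0 ?divr_ge0 ?subr_ge0 ?(ltW iw) //; lra.
Qed.

(** This is the quantitative form of the fact that e^w = 1 + w has no solution
    w <> 0 close to the imaginary axis. It stays linear in |w| near 0, which
    matters when the length of the averaging interval shrinks. *)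
Lemma cexp_mean_lower : exists eps c0 : R, [/\ 0 < eps, 0 < c0 &
  forall w, `|Rez w| <= eps ->
    c0 * Num.min 1 (normc w) <= normc (1 - cexp_mean w)].
Proof.
have [eps [c0 [e0 c00 h]]] := cexp_remainder_lower.
exists eps, c0; split => // w rw.
rewrite /cexp_mean; case: eqVneq => [->|w0].
  by rewrite subrr Normc.normc0 min_r ?ler01 // mulr0.
have n0 := normc_gt0 w0.
rewrite -(ler_pM2r n0) -Normc.normcM; apply: le_trans (h w rw) _.
rewrite mulrBl mul1r divfK // -(normcN (_ - _)) le_eqVlt; apply/orP; left.
by apply/eqP; congr normc; ring.
Qed.

Lemma cexp_mean_real_upper (r : R) : `|r| <= 1 / 2 ->
  normc (1 - cexp_mean r%:C) <= 2 * `|r|.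
Proof.
move=> r2; rewrite /cexp_mean; case: eqVneq => [_|rC].
  by rewrite subrr Normc.normc0 mulr_ge0.
have r0 : r != 0 by apply: contra rC => /eqP ->.
have -> : 1 - (cexp r%:C - 1) / r%:C = (- ((expR r - 1 - r) / r))%:C.
  rewrite cexp_real rmorphN fmorph_div !rmorphB rmorph1 /=.
  by field.
rewrite normc_real normrN normrM normfV ler_pdivrMr ?normr_gt0 //.
rewrite -mulrA -normrM -expr2 (ger0_norm (sqr_ge0 r)).
have e1 := expR_ge1Dx r.
have e2 := expR_ge1Dx (- r).
rewrite ger0_norm; last by lra.
move: r2; rewrite ler_norml => /andP[h1 h2].
have p : 0 < 1 - r by lra.
have : expR r <= (1 - r)^-1.
  by rewrite -[leLHS]invrK -expRN lef_pV2 ?posrE ?expR_gt0.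
move=> e3; have : (1 - r)^-1 <= 1 + r + 2 * r ^+ 2.
  rewrite -(ler_pM2r p) mulVf ?lt0r_neq0 // -subr_ge0.
  rewrite [X in 0 <= X](_ : _ = r ^+ 2 * (1 - 2 * r)); last by ring.
  by rewrite mulr_ge0 ?sqr_ge0 //; lra.
lra.
Qed.

End Multiplier.

(** * Removing an exponent by averaging *)

Section Deflation.
Variables (R : realType) (I : eqType).
Implicit Types (z w lam : R[i]) (mu x : I -> R[i]) (D : pred I) (s : seq I).

(** If g has the coefficients x, then g(t) - (1 / dl) times the integral of
    e^(- lam r) g(t + r) over 0 <= r <= dl has these coefficients. The
    exponent lam disappears. *)
Definition deflate lam (dl : R) mu x i : R[i] :=
  x i * (1 - cexp_mean ((mu i - lam) * dl%:C)).

Lemma segint_cexp_mean (t dl : R) z w : 0 < dl ->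
  segint t (t + dl) (fun r => Rez (z * cexp (w * r%:C))) =
  Rez (z * cexp_mean (w * dl%:C) * cexp (w * t%:C)) * dl.
Proof.
move=> dl0; have dlC : dl%:C != 0 by rewrite fmorph_eq0 lt0r_neq0.
have tdl : t <= t + dl by rewrite lerDl ltW.
have [->|w0] := eqVneq w 0.
  rewrite !mul0r cexp0 /cexp_mean eqxx !mulr1.
  transitivity (segint t (t + dl) (fun=> Rez z)).
    by apply: eq_segint => r; rewrite mul0r cexp0 mulr1.
  by rewrite segint_cst // addrAC subrr add0r.
rewrite /cexp_mean mulf_eq0 (negbTE w0) (negbTE dlC) /=.
transitivity (segint t (t + dl) (fun r => Rez (z / w * w * cexp (w * r%:C)))).
  by apply: eq_segint => r; rewrite divfK.
rewrite segint_Re_cexp // (_ : w * (t + dl)%:C = w * t%:C + w * dl%:C);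
  last by rewrite (rmorphD (real_complex R)) mulrDr.
rewrite cexpD -Re_mulr_real; congr Rez.
by field; rewrite w0 dlC.
Qed.

Lemma energy_le2 (a b : R) mu s x s1 x1 s2 x2 :
  (forall t, expsum mu s x t = expsum mu s1 x1 t + expsum mu s2 x2 t) ->
  energy a b mu s x <= 2 * energy a b mu s1 x1 + 2 * energy a b mu s2 x2.
Proof.
move=> h; rewrite /energy -!segintZ; try exact: sqr_normc_expsum_continuous.
rewrite -segintD;
  try by apply: continuous_scale; exact: sqr_normc_expsum_continuous.
apply: le_segint.
- exact: sqr_normc_expsum_continuous.
- by move=> t; apply: (@continuousD _ _ _
    (fun t => 2 * normc (expsum mu s1 x1 t) ^+ 2)
    (fun t => 2 * normc (expsum mu s2 x2 t) ^+ 2));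
    apply: continuous_scale; exact: sqr_normc_expsum_continuous.
- by move=> t _; rewrite h sqr_normcD.
Qed.

Lemma energy_le_cst (a b k : R) mu s x : a <= b ->
  (forall t, a <= t <= b -> normc (expsum mu s x t) ^+ 2 <= k) ->
  energy a b mu s x <= k * (b - a).
Proof.
move=> ab h; rewrite -segint_cst //; apply: le_segint h.
  exact: sqr_normc_expsum_continuous.
by move=> t; exact: cst_continuous.
Qed.

Lemma energy_ge_cst (a b k : R) mu s x : a <= b ->
  (forall t, a <= t <= b -> k <= normc (expsum mu s x t) ^+ 2) ->
  k * (b - a) <= energy a b mu s x.
Proof.
move=> ab h; rewrite -segint_cst //; apply: le_segint h.
  by move=> t; exact: cst_continuous.
exact: sqr_normc_expsum_continuous.
Qed.

(** Let w be the averaged value at t. The integral over [t, t + dl] of the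
    real part of conj(w) e^(- lam (r - t)) g(r) is dl |w|^2, and its integrand
    is at most |w|^2 / 2 + K |g(r)|^2 / 2 where K bounds the squares |e^(- lam
    (r - t))|^2. Hence |w|^2 is bounded by K / dl times the energy of g, at
    every t. *)
Lemma deflate_energy lam (dl T : R) mu s x : 0 < dl -> dl <= T ->
  energy 0 (T - dl) mu s (deflate lam dl mu x) <=
  (2 + 2 * (expR (2 * `|Rez lam| * dl) / dl) * T) * energy 0 T mu s x.
Proof.
move=> dl0 dlT; set K := expR _.
have K0 : 0 < K by exact: expR_gt0.
have T0 : 0 <= T by rewrite (le_trans (ltW dl0)).
set e := energy 0 T mu s x.
have e0 : 0 <= e by exact: energy_ge0.
pose y i := x i * cexp_mean ((mu i - lam) * dl%:C).
have split_t t : expsum mu s (deflate lam dl mu x) t =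
    expsum mu s x t + expsum mu s (fun i => - y i) t.
  rewrite /expsum -big_split; apply: eq_bigr => i _ /=.
  by rewrite /deflate /y; ring.
have Ny t : normc (expsum mu s (fun i => - y i) t) = normc (expsum mu s y t).
  rewrite -normcN /expsum -sumrN; congr normc; apply: eq_bigr => i _.
  by rewrite mulNr opprK.
have yle t : 0 <= t <= T - dl -> normc (expsum mu s y t) ^+ 2 <= K / dl * e.
  move=> /andP[t0 tT]; set w := expsum mu s y t.
  have cW (z : R[i]) : continuous (fun r : R =>
      Rez (z * cexp (- lam * (r - t)%:C) * expsum mu s x r)).
    rewrite (_ : (fun _ => _) = fun r : R => \sum_(i <- s)
       Rez (z * x i * cexp (lam * t%:C) * cexp ((mu i - lam) * r%:C))).
      by apply: continuous_sum => i; exact: Re_cexp_continuous.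
    apply/funext => r; rewrite /expsum mulr_sumr Re_sum.
    apply: eq_bigr => i _; congr Rez.
    rewrite (_ : - lam * (r - t)%:C = lam * t%:C - lam * r%:C); last first.
      by rewrite rmorphB; ring.
    by rewrite (mulrDl (mu i)) !cexpD mulNr; ring.
  have eqI : segint t (t + dl) (fun r : R =>
      Rez (w^*%C * cexp (- lam * (r - t)%:C) * expsum mu s x r)) =
      normc w ^+ 2 * dl.
    transitivity (segint t (t + dl) (fun r : R => \sum_(i <- s)
       Rez (w^*%C * x i * cexp (lam * t%:C) * cexp ((mu i - lam) * r%:C)))).
      apply: eq_segint => r; rewrite /expsum mulr_sumr Re_sum.
      apply: eq_bigr => i _; congr Rez.
      rewrite (_ : - lam * (r - t)%:C = lam * t%:C - lam * r%:C); last first.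
        by rewrite rmorphB; ring.
      by rewrite (mulrDl (mu i)) !cexpD mulNr; ring.
    rewrite segint_sum; last 2 first.
      by move=> i; exact: Re_cexp_continuous.
      by rewrite lerDl ltW.
    under eq_bigr do rewrite segint_cexp_mean //.
    rewrite -mulr_suml -Re_sum -Re_mulJ_normc {2}/w /expsum mulr_sumr.
    congr (Rez _ * _); apply: eq_bigr => i _.
    rewrite (_ : mu i * t%:C = lam * t%:C + (mu i - lam) * t%:C); last by ring.
    by rewrite cexpD /y; ring.
  have : normc w ^+ 2 * dl <= segint t (t + dl) (fun r =>
      normc w ^+ 2 / 2 + K / 2 * normc (expsum mu s x r) ^+ 2).
    rewrite -eqI; apply: le_segint => //.
      move=> r; apply: (@continuousD _ _ _ (cst (normc w ^+ 2 / 2))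
        (fun r => K / 2 * normc (expsum mu s x r) ^+ 2)).
        exact: cst_continuous.
      by apply: continuous_scale; exact: sqr_normc_expsum_continuous.
    move=> r /andP[tr rt]; apply: (le_trans (ler_norm _)).
    apply: (le_trans (Re_le_normc _)).
    rewrite 2!Normc.normcM normc_conj normc_cexp Re_mulr_real cReN.
    set E := expR _; set n := normc (expsum _ _ _ _).
    have EK : E ^+ 2 <= K.
      rewrite /E -expRM_natl ler_expR /K.
      have := ler_norm (- Rez lam); rewrite normrN.
      have := normr_ge0 (Rez lam); nra.
    have n0 : 0 <= n by exact: normc_ge0.
    have w0 : 0 <= normc w by exact: normc_ge0.
    have E0 : 0 <= E by exact: expR_ge0.
    have : 0 <= (normc w - E * n) ^+ 2 by exact: sqr_ge0.
    have : E ^+ 2 * n ^+ 2 <= K * n ^+ 2 by rewrite ler_wpM2r ?sqr_ge0.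
    nra.
  have cK : continuous (fun r : R => K / 2 * normc (expsum mu s x r) ^+ 2).
    by apply: continuous_scale; exact: sqr_normc_expsum_continuous.
  rewrite segintD //; last by move=> r; exact: cst_continuous.
  rewrite segint_cst ?lerDl ?(ltW dl0) // segintZ; last first.
    exact: sqr_normc_expsum_continuous.
  have : energy t (t + dl) mu s x <= e by apply: energy_widen => //; lra.
  rewrite /energy -(ler_pM2l K0) => h1 h2.
  rewrite mulrAC ler_pdivlMr //; lra.
apply: le_trans (energy_le2 _ _ split_t) _.
rewrite [leRHS]mulrDl; apply: lerD.
  rewrite ler_pM2l //; apply: energy_widen => //; lra.
rewrite -!mulrA ler_pM2l // (_ : _ * (_ * _) = K / dl * e * T); last by ring.
have Ke : 0 <= K / dl * e by rewrite mulr_ge0 // divr_ge0 ?ltW.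
apply: (@le_trans _ _ (K / dl * e * (T - dl - 0))).
  apply: energy_le_cst; first by rewrite subr_ge0.
  by move=> t tT; rewrite Ny yle.
by rewrite ler_wpM2l // subr0 lerBlDr lerDl ltW.
Qed.
End Deflation.

Section Deflations.
Variables (R : realType) (I : eqType).
Implicit Types (mu x : I -> R[i]) (s : seq I).

(** Each step shortens the interval by dl and costs a factor that depends on
    dl but not on the sum. *)
Lemma deflate_iter_energy (lam : R[i]) (dl T : R) mu s x p :
  0 < dl -> dl * p%:R <= T ->
  energy 0 (T - dl * p%:R) mu s
    (fun i => x i * (1 - cexp_mean ((mu i - lam) * dl%:C)) ^+ p) <=
  (2 + 2 * (expR (2 * `|Rez lam| * dl) / dl) * T) ^+ p * energy 0 T mu s x.
Proof.
move=> dl0; set C := 2 + _.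
have T0C : 0 <= T -> 0 <= C.
  by move=> T0; rewrite /C addr_ge0 // mulr_ge0 // mulr_ge0 // divr_ge0 ?expR_ge0 ?ltW.
elim: p => [|p ih] hp.
  rewrite mulr0 subr0 expr0 mul1r le_eqVlt; apply/orP; left; apply/eqP.
  apply: eq_segint => t; congr (normc _ ^+ 2).
  by apply: eq_bigr => i _; rewrite expr0 mulr1.
have dp : dl * p%:R + dl <= T.
  by move: hp; rewrite -natr1 mulrDr mulr1.
have p0 : 0 <= dl * p%:R by rewrite mulr_ge0 // ltW.
have T0 : 0 <= T by lra.
set y := fun i => x i * (1 - cexp_mean ((mu i - lam) * dl%:C)) ^+ p in ih.
have -> : energy 0 (T - dl * p.+1%:R) mu s
    (fun i => x i * (1 - cexp_mean ((mu i - lam) * dl%:C)) ^+ p.+1) =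
    energy 0 (T - dl * p%:R - dl) mu s (deflate lam dl mu y).
  rewrite (_ : T - dl * p.+1%:R = T - dl * p%:R - dl); last first.
    by rewrite -natr1; ring.
  apply: eq_segint => t; congr (normc _ ^+ 2); apply: eq_bigr => i _.
  by rewrite /deflate /y exprSr -!mulrA.
apply: le_trans (deflate_energy lam mu s y dl0 _) _; first by lra.
rewrite exprS -[leRHS]mulrA; apply: ler_pM; rewrite ?energy_ge0 //.
- rewrite addr_ge0 // mulr_ge0 //; last by lra.
  by rewrite mulr_ge0 // divr_ge0 ?expR_ge0 ?ltW.
- rewrite /C lerD2l; apply: ler_wpM2l; last by lra.
  by rewrite mulr_ge0 // divr_ge0 ?expR_ge0 ?ltW.
- by apply: ih; lra.
Qed.

Lemma expsum_filter mu s x (P : pred I) t : expsum mu s x t =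
  expsum mu [seq i <- s | P i] x t + expsum mu [seq i <- s | ~~ P i] x t.
Proof. by rewrite /expsum !big_filter [LHS](bigID P). Qed.

Lemma energy_opp (a b : R) mu s x :
  energy a b mu s (fun i => - x i) = energy a b mu s x.
Proof.
apply: eq_segint => t; rewrite /expsum -normcN -sumrN.
by congr (normc _ ^+ 2); apply: eq_bigr => i _; rewrite mulNr opprK.
Qed.

Lemma energy_filter_le (a b : R) mu s x (P : pred I) :
  energy a b mu [seq i <- s | P i] x <=
  2 * energy a b mu s x + 2 * energy a b mu [seq i <- s | ~~ P i] x.
Proof.
rewrite -(energy_opp _ _ _ [seq i <- s | ~~ P i]).
apply: energy_le2 => t; rewrite (expsum_filter mu s x P) -addrA.
rewrite /expsum -[X in _ = _ + X]big_split /= [X in _ = _ + X]big1 ?addr0 // => i _.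
by rewrite mulNr subrr.
Qed.

End Deflations.

(** * Adding finitely many exponents *)

Section AddExponent.
Variables (R : realType) (I : eqType).
Implicit Types (mu x : I -> R[i]) (D : pred I) (s : seq I).

Lemma exists_lower_bound_seq (T : eqType) (l : seq T) (f : T -> R) :
  (forall i, i \in l -> 0 < f i) ->
  exists2 d : R, 0 < d & forall i, i \in l -> d <= f i.
Proof.
elim: l => [|j k ih] nz; first by exists 1.
have [d d0 hd] : exists2 d : R, 0 < d & forall i, i \in k -> d <= f i.
  by apply: ih => i ik; apply: nz; rewrite inE ik orbT.
exists (Num.min d (f j)); first by rewrite lt_min d0 nz ?mem_head.
move=> i; rewrite inE => /orP[/eqP->|ik]; first by rewrite ge_min lexx orbT.
by rewrite ge_min hd.
Qed.

Lemma energy1_le mu (i : I) x (T : R) : 0 <= T ->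
  energy 0 T mu [:: i] x <=
  expR (2 * `|Rez (mu i)| * T) * T * normc (x i) ^+ 2.
Proof.
move=> T0; rewrite mulrAC; apply: le_trans (energy_le_cst T0 _) _; last first.
  by rewrite subr0.
move=> t /andP[t0 tT]; rewrite /expsum big_seq1 Normc.normcM exprMn mulrC.
rewrite ler_wpM2r ?sqr_ge0 // normc_cexp Re_mulr_real -expRM_natl ler_expR.
have := ler_norm (Rez (mu i)); have := normr_ge0 (Rez (mu i)); nra.
Qed.

Lemma energy1_ge mu (i : I) x (T : R) : 0 <= T ->
  expR (- 2 * `|Rez (mu i)| * T) * T * normc (x i) ^+ 2 <=
  energy 0 T mu [:: i] x.
Proof.
move=> T0; rewrite mulrAC.
have := @energy_ge_cst R I 0 T
  (expR (- 2 * `|Rez (mu i)| * T) * normc (x i) ^+ 2) mu [:: i] x T0.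
rewrite subr0; apply.
move=> t /andP[t0 tT]; rewrite /expsum big_seq1 Normc.normcM exprMn mulrC.
rewrite ler_wpM2l ?sqr_ge0 // normc_cexp Re_mulr_real -expRM_natl ler_expR.
have := ler_norm (- Rez (mu i)); have := normr_ge0 (Rez (mu i)).
rewrite normrN; nra.
Qed.

Lemma big_split_at (V : nmodType) s (i0 : I) (F : I -> V) : uniq s ->
  \sum_(i <- s) F i =
  (if i0 \in s then F i0 else 0) + \sum_(i <- [seq i <- s | i != i0]) F i.
Proof.
move=> us; rewrite big_filter; case: ifPn => i0s; first exact: bigD1_seq.
rewrite add0r big_seq [RHS]big_seq_cond; apply: eq_bigl => i.
by case: eqVneq => [->|]; rewrite ?andbT ?andbF // (negbTE i0s).
Qed.

Lemma all_filter_predU1 D (i0 : I) s : all (predU1 i0 D) s ->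
  all D [seq i <- s | i != i0].
Proof.
move=> /allP h; apply/allP => i; rewrite mem_filter => /andP[ii0 /h].
by rewrite /= (negbTE ii0).
Qed.

Lemma expsum_split_at mu s (i0 : I) x t : uniq s ->
  expsum mu s x t =
  expsum mu [:: i0] (fun i => if i0 \in s then x i else 0) t +
  expsum mu [seq i <- s | i != i0] x t.
Proof.
move=> us; rewrite /expsum big_seq1 (big_split_at i0) //.
by case: ifP; rewrite ?mul0r.
Qed.

Lemma direct_inequality_add mu D (T : R) (i0 : I) : 0 <= T ->
  direct_inequality mu D T -> direct_inequality mu (predU1 i0 D) T.
Proof.
move=> T0 [B B0 hB]; set K := expR (2 * `|Rez (mu i0)| * T) * T.
have K0 : 0 <= K by rewrite mulr_ge0 ?expR_ge0.
exists (2 * K + 2 * B); first by rewrite ltr_wpDl ?mulr_ge0 ?mulr_gt0.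
move=> s x us hs; pose s' := [seq i <- s | i != i0].
have := energy_le2 0 T (fun t => expsum_split_at mu i0 x t us).
move=> /le_trans; apply.
have := hB s' x (filter_uniq _ us) (all_filter_predU1 hs).
have := energy1_le mu i0 (fun i => if i0 \in s then x i else 0) T0.
rewrite -/K (big_split_at i0 _ us); set S' := \sum_(i <- _) _.
have S'0 : 0 <= S' by apply: sumr_ge0 => i _; rewrite sqr_ge0.
set e1 := energy _ _ _ _ _; set e2 := energy _ _ _ _ _ => h1 h2.
have : normc (if i0 \in s then x i0 else 0) ^+ 2 =
    if i0 \in s then normc (x i0) ^+ 2 else 0.
  by case: ifP => // _; rewrite Normc.normc0 expr0n.
move=> e; move: h1; rewrite e; set y := (if _ then _ else _) => h1.
have y0 : 0 <= y by rewrite /y -e sqr_ge0.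
nra.
Qed.

(** Averaging removes the exponent of i0 and, the interval being slightly
    shortened, the inequality for D controls the other coefficients times
    their multipliers. The multipliers are bounded below because the exponents
    in D stay away from that of i0 and have bounded real parts. The term of
    index i0 is then the difference of two functions of controlled energy. *)
Lemma inverse_inequality_add mu D (T T' : R) (i0 : I) (A d : R) :
  0 < T' -> T' < T -> inverse_inequality mu D T' -> direct_inequality mu D T ->
  (forall i, D i -> `|Rez (mu i)| <= A) ->
  0 < d -> (forall i, D i -> d <= normc (mu i - mu i0)) ->
  inverse_inequality mu (predU1 i0 D) T.
Proof.
move=> T'0 T'T [K K0 hK] [B B0 hB] hA d0 hd.
have [eps [c0 [eps0 c00 hc]]] := cexp_mean_lower R.
set lam := mu i0; pose L := `|A| + `|Rez lam| + 1.
have L0 : 0 < L by rewrite ltr_wpDl // addr_ge0.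
pose dl := Num.min (T - T') (eps / L).
have dl0 : 0 < dl by rewrite lt_min subr_gt0 T'T divr_gt0.
have dlT : dl <= T - T' by rewrite ge_min lexx.
have dlL : dl * L <= eps by rewrite -ler_pdivlMr // ge_min lexx orbT.
pose m0 := c0 * Num.min 1 (d * dl).
have m00 : 0 < m0 by rewrite mulr_gt0 // lt_min ltr01 mulr_gt0.
have hm i : D i -> m0 <= normc (1 - cexp_mean ((mu i - lam) * dl%:C)).
  move=> Di; apply: le_trans (hc _ _); last first.
    rewrite Re_mulr_real normrM (gtr0_norm dl0) mulrC; apply: le_trans dlL.
    rewrite ler_pM2l // cReD cReN (le_trans (ler_normB _ _)) // /L.
    by have := hA _ Di; have := ler_norm A; lra.
  rewrite /m0 ler_pM2l // le_min2 // Normc.normcM normc_real (gtr0_norm dl0).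
  by rewrite ler_pM2r // hd.
set C1 := 2 + 2 * (expR (2 * `|Rez lam| * dl) / dl) * T.
have T0 : 0 < T by rewrite (lt_trans T'0).
have C10 : 0 < C1.
  by rewrite /C1 addr_gt0 // !mulr_gt0 // ?invr_gt0 ?expR_gt0.
pose K1 := m0 ^- 2 * K * C1.
have K10 : 0 < K1.
  by rewrite /K1 mulr_gt0 // mulr_gt0 // invr_gt0 exprn_gt0.
pose E := expR (- 2 * `|Rez lam| * T) * T.
have E0 : 0 < E by rewrite mulr_gt0 ?expR_gt0.
exists (E^-1 * (2 + 2 * (B * K1)) + K1).
  have BK : 0 < 2 + 2 * (B * K1) by rewrite addr_gt0 // mulr_gt0 // mulr_gt0.
  by rewrite addr_gt0 // mulr_gt0 // invr_gt0.
move=> s x us hs; pose s' := [seq i <- s | i != i0].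
have us' : uniq s' by exact: filter_uniq.
have hs' : all D s' by exact: all_filter_predU1 hs.
set e := energy 0 T mu s x.
have S'le : \sum_(i <- s') normc (x i) ^+ 2 <= K1 * e.
  have := hK s' (deflate lam dl mu x) us' hs'.
  have -> : energy 0 T' mu s' (deflate lam dl mu x) =
      energy 0 T' mu s (deflate lam dl mu x).
    apply: eq_segint => t; congr (normc _ ^+ 2).
    have dz : deflate lam dl mu x i0 = 0.
      by rewrite /deflate /lam subrr mul0r /cexp_mean eqxx subrr mulr0.
    rewrite [RHS](expsum_split_at mu i0) // /expsum big_seq1 dz.
    by rewrite if_same mul0r add0r.
  have h1 : energy 0 T' mu s (deflate lam dl mu x) <= C1 * e.
    apply: le_trans (deflate_energy lam mu s x dl0 _); last by lra.
    by apply: energy_widen => //; lra.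
  move=> h2; rewrite /K1 -!mulrA ler_pdivlMl ?exprn_gt0 //.
  apply: (@le_trans _ _ (K * energy 0 T' mu s (deflate lam dl mu x))); last first.
    by rewrite ler_pM2l.
  apply: le_trans h2; rewrite mulr_sumr big_seq [leRHS]big_seq.
  apply: ler_sum => i si; rewrite /deflate Normc.normcM [leRHS]exprMn [leLHS]mulrC.
  rewrite ler_wpM2l ?sqr_ge0 //.
  rewrite ler_pXn2r ?nnegrE ?normc_ge0 ?(ltW m00) //.
  exact/hm/(allP hs').
rewrite (big_split_at i0) // [leRHS]mulrDl; apply: lerD => //.
rewrite -mulrA ler_pdivlMl //.
have := energy1_ge mu i0 (fun i => if i0 \in s then x i else 0) (ltW T0).
rewrite -/lam -/E => h1.
have e' : normc (if i0 \in s then x i0 else 0) ^+ 2 =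
    if i0 \in s then normc (x i0) ^+ 2 else 0.
  by case: ifP => // _; rewrite Normc.normc0 expr0n.
rewrite e' in h1; apply: (le_trans h1).
apply: (@le_trans _ _ (2 * e + 2 * energy 0 T mu s' (fun i => - x i))).
  apply: energy_le2 => t; rewrite (expsum_split_at mu i0 x t us) -addrA.
  rewrite -/s' /expsum -big_split /= [X in _ + X]big1 ?addr0 // => i _.
  by rewrite mulNr subrr.
rewrite energy_opp.
rewrite [leRHS]mulrDl lerD2l -[leRHS]mulrA ler_pM2l //.
apply: le_trans (hB s' x us' hs') _.
by rewrite -mulrA ler_pM2l.
Qed.

(** The inverse inequality is required on every interval longer than T0,
    because adding an exponent consumes an arbitrarily small length. The bound
    on the real parts keeps the multipliers in the strip where they are
    bounded below. *)
Definition frame_above (T0 : R) mu D :=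
  [/\ exists A : R, forall i, D i -> `|Rez (mu i)| <= A,
      forall T, T0 < T -> inverse_inequality mu D T &
      forall T, 0 < T -> direct_inequality mu D T].

Lemma frame_above_add (T0 : R) mu D (i0 : I) (d : R) : 0 <= T0 ->
  0 < d -> (forall i, D i -> d <= normc (mu i - mu i0)) ->
  frame_above T0 mu D -> frame_above T0 mu (predU1 i0 D).
Proof.
move=> T00 d0 hd [[A hA] hI hD]; split.
- exists (Num.max A `|Rez (mu i0)|) => i /= /orP[/eqP->|/hA h].
    by rewrite le_max lexx orbT.
  by rewrite le_max h.
- move=> T T0T; pose T' := (T0 + T) / 2.
  apply: (inverse_inequality_add (T' := T')) hA d0 hd; rewrite /T'; try lra.
    by apply: hI; lra.
  by apply: hD; lra.
- by move=> T T0'; apply: direct_inequality_add; [exact: ltW|exact: hD].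
Qed.

Lemma eq_frame_above (T0 : R) mu D D' : D =1 D' ->
  frame_above T0 mu D -> frame_above T0 mu D'.
Proof. by move=> /funext ->. Qed.

Lemma frame_above_adds (T0 : R) mu D (l : seq I) : 0 <= T0 ->
  (forall i, i \in l -> exists2 d : R, 0 < d &
     forall j, D j -> d <= normc (mu j - mu i)) ->
  {in l &, injective mu} ->
  frame_above T0 mu D -> frame_above T0 mu [pred i | D i || (i \in l)].
Proof.
move=> T00; elim: l => [|i0 l ih] sep inj fD.
  by apply: eq_frame_above fD => i /=; rewrite orbF.
have {ih} fl : frame_above T0 mu [pred i | D i || (i \in l)].
  apply: ih => // [i il|i j il jl]; first by apply: sep; rewrite inE il orbT.
  by apply: inj; rewrite inE ?il ?jl orbT.
have [i0l|i0l] := boolP (i0 \in l).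
  apply: eq_frame_above fl => i /=; rewrite inE.
  by case: eqVneq => // ->; rewrite i0l !orbT.
have [d d0 hd] := sep i0 (mem_head _ _).
have [d' d'0 hd'] : exists2 d' : R, 0 < d' &
    forall j, j \in l -> d' <= normc (mu j - mu i0).
  have nz j : j \in l -> 0 < normc (mu j - mu i0).
    move=> jl; apply: normc_gt0; rewrite subr_eq0.
    apply: contra i0l => /eqP/inj <- //; rewrite inE ?eqxx // jl orbT //.
  exact: exists_lower_bound_seq nz.
apply: (@eq_frame_above _ _ (predU1 i0 [pred i | D i || (i \in l)])).
  by move=> i /=; rewrite inE orbCA.
apply: (@frame_above_add _ _ _ _ (Num.min d d')) => //.
  by rewrite lt_min d0.
by move=> i /= /orP[/hd|/hd'] h; rewrite ge_min h // orbT.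
Qed.

End AddExponent.

(** * Sequences and series of real numbers *)

Section Sequences.
Variable R : realType.

(** By induction, from 2 |A a b| <= a^2 Q + b^2 P when A^2 <= P Q. *)
Lemma cauchy_schwarz_sum (I : Type) (s : seq I) (f g : I -> R) :
  (\sum_(i <- s) f i * g i) ^+ 2 <=
  (\sum_(i <- s) f i ^+ 2) * (\sum_(i <- s) g i ^+ 2).
Proof.
elim: s => [|i s ih]; first by rewrite !big_nil expr0n mul0r.
rewrite !big_cons; move: ih.
have : 0 <= \sum_(i <- s) f i ^+ 2 by apply: sumr_ge0 => j _; exact: sqr_ge0.
have : 0 <= \sum_(i <- s) g i ^+ 2 by apply: sumr_ge0 => j _; exact: sqr_ge0.
set P := \sum_(i <- s) f i ^+ 2; set Q := \sum_(i <- s) g i ^+ 2.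
set A := \sum_(i <- s) f i * g i; set a := f i; set b := g i => Q0 P0 APQ.
suff h : 2 * (A * (a * b)) <= a ^+ 2 * Q + b ^+ 2 * P.
  rewrite -subr_ge0 [X in 0 <= X](_ : _ = (P * Q - A ^+ 2) +
    (a ^+ 2 * Q + b ^+ 2 * P - 2 * (A * (a * b)))); last by ring.
  by rewrite addr_ge0 // subr_ge0.
apply: (le_trans (ler_norm _)).
have rhs0 : 0 <= a ^+ 2 * Q + b ^+ 2 * P by rewrite addr_ge0 // mulr_ge0 ?sqr_ge0.
rewrite -ler_sqr ?nnegrE // real_normK ?num_real //.
apply: (@le_trans _ _ (4 * (a ^+ 2 * b ^+ 2) * (P * Q))).
  rewrite [leLHS](_ : _ = 4 * (a ^+ 2 * b ^+ 2) * A ^+ 2); last by ring.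
  by apply: ler_wpM2l => //; rewrite mulr_ge0 // mulr_ge0 ?sqr_ge0.
rewrite -subr_ge0 [X in 0 <= X](_ : _ = (a ^+ 2 * Q - b ^+ 2 * P) ^+ 2).
  exact: sqr_ge0.
by ring.
Qed.

(** The 2^K terms between 2^K and 2^(K + 1) add up to at most (2 / 2^(2
    nu))^K, and 2 nu > 1. *)
Lemma p_series_bounded (nu : R) : 1 / 2 < nu ->
  exists2 S : R, 0 < S & forall m n,
    (0 < m)%N -> \sum_(m <= k < n) (k%:R `^ nu) ^- 2 <= S.
Proof.
move=> nu2; have nu0 : 0 < nu by apply: lt_trans nu2; lra.
pose b : R := 2 `^ nu; have b0 : 0 < b by rewrite powR_gt0.
have b2 : 2 < b ^+ 2.
  rewrite -powR_mulrn ?ltW // -powRrM -[X in X < _]powRr1 //.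
  rewrite lt_neqAle; apply/andP; split; last by apply: ler_powR; rewrite ?ler1n //; lra.
  apply/eqP => /(congr1 (@ln R)); rewrite !ln_powR mul1r => /eqP.
  rewrite -subr_eq0 -{1}[ln 2]mul1r -mulrBl mulf_eq0 => /orP[/eqP|/eqP]; first by lra.
  have l2 : 0 < ln 2 :> R by rewrite ln_gt0 // ltr1n.
  by lra.
pose q : R := 2 / b ^+ 2.
have bb0 : 0 < b ^+ 2 by rewrite exprn_gt0.
have q0 : 0 < q by rewrite divr_gt0.
have q1 : q < 1 by rewrite ltr_pdivrMr // mul1r.
have t0 k : 0 <= (k%:R `^ nu) ^- 2 :> R by rewrite invr_ge0 exprn_ge0 ?powR_ge0.
have block K : \sum_(1 <= k < 2 ^ K) (k%:R `^ nu) ^- 2 <= (1 - q ^+ K) / (1 - q).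
  elim: K => [|K ih]; first by rewrite expn0 big_geq // expr0 subrr mul0r.
  rewrite (@big_cat_nat _ _ _ (2 ^ K)) /=; last 2 first.
    by rewrite expn_gt0.
    by rewrite leq_exp2l.
  have -> : (1 - q ^+ K.+1) / (1 - q) = (1 - q ^+ K) / (1 - q) + q ^+ K.
    by rewrite exprS; field; rewrite subr_eq0 eq_sym lt_eqF.
  apply: lerD ih _.
  apply: (@le_trans _ _ (\sum_(2 ^ K <= k < 2 ^ K.+1) (b ^+ K) ^- 2)).
    apply: ler_sum_nat => k /andP[Kk _].
    have bK : b ^+ K = (2 ^ K)%:R `^ nu.
      by rewrite natrX -powR_mulrn ?ltW // -powRrM mulrC powRrM powR_mulrn.
    have p1 : 0 < (2 ^ K)%:R :> R by rewrite ltr0n expn_gt0.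
    have kr : (2 ^ K)%:R <= k%:R :> R by rewrite ler_nat.
    rewrite bK lef_pV2 ?posrE ?exprn_gt0 ?powR_gt0 ?(lt_le_trans p1) //.
    rewrite ler_pXn2r ?nnegrE ?powR_ge0 //.
    by apply: ge0_ler_powR => //; rewrite ?nnegrE ?ltW // (lt_le_trans p1).
  rewrite sumr_const_nat expnS mul2n -addnn addnK -mulr_natr natrX.
  rewrite le_eqVlt; apply/orP; left; apply/eqP.
  by rewrite /q expr_div_n [LHS]mulrC -!exprM mulnC.
exists (1 - q)^-1; first by rewrite invr_gt0 subr_gt0.
move=> m n m0.
apply: (@le_trans _ _ (\sum_(1 <= k < 2 ^ n) (k%:R `^ nu) ^- 2)).
  apply: ler_uniq_sum; rewrite ?iota_uniq // => k.
  rewrite !mem_index_iota => /andP[mk kn].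
  by rewrite (leq_trans m0 mk) (ltn_trans kn) // ltn_expl.
apply: (le_trans (block n)); rewrite ler_pdivrMr ?subr_gt0 //.
by rewrite mulVf ?subr_eq0 1?eq_sym ?lt_eqF // gerBl exprn_ge0 // ltW.
Qed.

Lemma limn_einf_ge_near (u : nat -> R) (l c : R) :
  limn_einf (fun n => (u n)%:E) = l%:E -> c < l ->
  exists N, forall n, (N <= n)%N -> c <= u n.
Proof.
move=> ul cl.
have sup_l : ereal_sup (range (einfs (fun n => (u n)%:E))) = l%:E.
  rewrite -ul limn_einf_lim; apply/esym/cvg_lim => //; exact: cvg_einfs_sup.
have : (c%:E < ereal_sup (range (einfs (fun n => (u n)%:E))))%E.
  by rewrite sup_l lte_fin.
move=> /ereal_sup_gt[_ [N _ <-] hN]; exists N => n Nn; rewrite -lee_fin.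
apply: (le_trans (ltW hN)).
by apply: ereal_inf_lbound; exists n => //=.
Qed.

Lemma cvg_dist_near (u : nat -> R) (l e : R) : u n @[n --> \oo] --> l ->
  0 < e -> exists N, forall n, (N <= n)%N -> `|u n - l| <= e.
Proof.
move=> /cvgrPdist_le ul e0; have [N _ hN] := ul _ e0.
by exists N => n /hN; rewrite distrC.
Qed.

Lemma exists_upper_bound_near (u : nat -> R) (l : R) : u n @[n --> \oo] --> l ->
  exists2 A : R, 0 < A & forall n, `|u n| <= A.
Proof.
move=> ul; have [N hN] := cvg_dist_near ul ltr01.
pose A := `|l| + 1 + \sum_(0 <= n < N) `|u n|.
have S0 : 0 <= \sum_(0 <= n < N) `|u n| by apply: sumr_ge0.
exists A => [|n]; first by rewrite /A ltr_wpDr // ltr_wpDl.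
have [/hN h|nN] := leqP N n.
  rewrite -[u n](subrK l) /A; apply: (le_trans (ler_normD _ _)).
  have := normr_ge0 l; lra.
rewrite /A ler_wpDl ?addr_ge0 //.
rewrite (bigD1_seq n) ?iota_uniq ?mem_index_iota //= lerDl.
by apply: sumr_ge0.
Qed.

End Sequences.

(** * The exponents of the series *)

Section Frequencies.
Variables (R : realType) (omega : nat -> R[i]).
Variables (gamma alpha : R).
Hypothesis gap : limn_einf (fun n : nat =>
     (Rez (omega n.+1) - Rez (omega n))%:E) = gamma%:E.
Hypothesis lim_Im : Imz (omega n) @[n --> \oo] --> alpha.
Hypothesis gamma0 : 0 < gamma.
Hypothesis alpha0 : 0 < alpha.

(** The hypothesis is an open condition on (gamma, alpha), so it survives
    replacing gamma by a smaller gap g and alpha by a larger bound beta. The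
    gaps are eventually larger than an intermediate g' > g; this is what turns
    the increments into the lower bound g n for the real parts themselves,
    whatever the first frequencies are. *)
Lemma high_frequencies (th : R) : 4 * alpha ^+ 2 + th ^+ 2 < gamma ^+ 2 / 4 ->
  exists g beta N, [/\ 0 < g, 4 * beta ^+ 2 + th ^+ 2 < g ^+ 2 / 4,
    forall n, (N <= n)%N -> 0 <= Imz (omega n) <= beta,
    forall n, (N <= n)%N -> g * n%:R <= Rez (omega n) &
    forall m n, (N <= m <= n)%N ->
      g * (n%:R - m%:R) <= Rez (omega n) - Rez (omega m)].
Proof.
move=> hth; pose F := gamma ^+ 2 / 4 - 4 * alpha ^+ 2 - th ^+ 2.
have F0 : 0 < F by rewrite /F; lra.
pose L := 8 * alpha + 4 + gamma / 2.
have L0 : 0 < L by rewrite /L; move: gamma0 alpha0; lra.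
(* The slack F decreases by at most e L when gamma and alpha move by e. *)
pose e := Num.min (Num.min 1 (gamma / 2)) (Num.min alpha (F / (2 * L))).
have e0 : 0 < e by rewrite !lt_min ltr01 alpha0 !divr_gt0 ?mulr_gt0.
have e1 : e <= 1 by rewrite !ge_min lexx.
have eg : e <= gamma / 2 by rewrite !ge_min lexx orbT.
have ea : e <= alpha by rewrite !ge_min lexx !orbT.
have eF : e * (2 * L) <= F.
  by rewrite -ler_pdivlMr ?mulr_gt0 // !ge_min lexx !orbT.
pose g := gamma - e; pose g' := gamma - e / 2; pose beta := alpha + e.
have g0 : 0 < g by rewrite /g; move: gamma0; lra.
have [|N1 hN1] := @limn_einf_ge_near R _ _ g' gap.
  by rewrite /g'; move: gamma0; lra.
have [N2 hN2] := cvg_dist_near lim_Im e0.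
have mono m n : (N1 <= m <= n)%N ->
    g' * (n%:R - m%:R) <= Rez (omega n) - Rez (omega m).
  move=> /andP[N1m mn]; rewrite -(subnK mn); elim: (n - m)%N => [|k ih].
    by rewrite add0n !subrr mulr0.
  have := hN1 (k + m)%N (leq_trans N1m (leq_addl _ _)).
  rewrite addSn -natr1; lra.
(* From X on, the advantage e / 2 = g' - g makes up for the start at N1. *)
pose X := (g' * N1%:R - Rez (omega N1)) * (2 / e).
pose N3 := Num.truncn `|X|; have hX : X <= N3.+1%:R.
  by rewrite (le_trans (ler_norm _)) // ltW // truncnS_gt.
exists g, beta, (maxn (maxn N1 N2) N3.+1); split => //.
- have : e ^+ 2 <= e by rewrite expr2 ler_piMr // ltW.
  rewrite /g /beta; move: eF; rewrite /L /F; nra.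
- move=> n; rewrite !geq_max => /andP[/andP[_ /hN2]].
  by rewrite /beta ler_norml => /andP[h1 h2] _; apply/andP; split; lra.
- move=> n; rewrite !geq_max => /andP[/andP[n1 _] n3].
  have := mono N1 n; rewrite leqnn n1 => /(_ isT) h.
  have nX : X <= n%:R by rewrite (le_trans hX) // ler_nat.
  have : g' * N1%:R - Rez (omega N1) <= n%:R * (e / 2).
    by rewrite -ler_pdivrMr ?divr_gt0 // invf_div.
  rewrite /g; rewrite /g' in h *; lra.
- move=> m n; rewrite !geq_max => /andP[/andP[/andP[m1 _] _] mn].
  have := mono m n; rewrite m1 mn => /(_ isT); apply: le_trans.
  by rewrite ler_wpM2r ?subr_ge0 ?ler_nat // /g /g'; lra.
Qed.

End Frequencies.

Section Exponents.
Variables (R : realType).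
Implicit Types (omega : nat -> R[i]) (rho : nat -> R).

(** The frequencies are indexed by the nonzero integers, so that the index 0
    is free to carry the exponent 0 of the constants. *)
Definition exponent omega rho (i : int + nat) : R[i] :=
  match i with
  | inl k => if k == 0 then 0 else 'i%C * freqZ omega k
  | inr n => (rho n)%:C
  end.

Lemma iE (z : R[i]) : 'i%C * z = - Imz z +i* Rez z.
Proof.
case: z => a b; apply/eqP; rewrite eq_complex /=.
by apply/andP; split; apply/eqP; ring.
Qed.

(** The reflection that defines the frequencies of negative index reverses the
    sign of the real part. For indices of opposite signs the gap follows from
    the linear lower bound on both real parts. *)
Lemma freqZ_bounds omega (g beta : R) N : 0 < g ->
  (forall n, (N <= n)%N -> 0 <= Imz (omega n) <= beta) ->
  (forall n, (N <= n)%N -> g * n%:R <= Rez (omega n)) ->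
  (forall m n, (N <= m <= n)%N ->
      g * (n%:R - m%:R) <= Rez (omega n) - Rez (omega m)) ->
  [/\ forall k : int, (N <= `|k|)%N -> 0 <= Imz (freqZ omega k) <= beta,
      forall k : int, (N <= `|k|)%N ->
        g * `|k%:~R| <= `|Rez (freqZ omega k)| &
      forall k l : int, (N <= `|k|)%N -> (N <= `|l|)%N ->
        g * `|(k - l)%:~R| <= `|Rez (freqZ omega k) - Rez (freqZ omega l)|].
Proof.
move=> g0 hb hlin hmono; split.
- by move=> [n|n] /= h; rewrite ?cImN ?cImJ ?opprK; exact: hb.
- move=> [n|n] h; have := hlin _ h.
    by rewrite /= normr_nat => h'; apply: (le_trans h'); exact: ler_norm.
  rewrite /= NegzE mulrNz normrN cReN cReJ normrN normr_nat => h'.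
  by apply: (le_trans h'); exact: ler_norm.
have main (k l : int) : l < k -> (N <= `|k|)%N -> (N <= `|l|)%N ->
    g * (k - l)%:~R <= Rez (freqZ omega k) - Rez (freqZ omega l).
  case: k l => [m|m] [n|n] // lk hk hl.
  - have := hmono n m; rewrite (hl : (N <= n)%N) => h; rewrite mulrzBr; apply: h.
    by apply: ltnW; rewrite -ltz_nat.
  - rewrite [freqZ _ (Negz n)]/= cReN cReJ opprK NegzE opprK mulrzDr mulrDr; apply: lerD.
      exact: hlin.
    exact: hlin.
  - rewrite /= !cReN !cReJ opprK [leRHS]addrC.
    have := hmono m.+1 n.+1 => h.
    rewrite !NegzE opprK (addrC (- _)) mulrzBr; apply: h.
    by rewrite (hk : (N <= m.+1)%N) /=; move: lk; rewrite !NegzE; lia.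
move=> k l hk hl; have [lk|kl|->] := ltgtP l k.
- rewrite ger0_norm ?ler0z ?subr_ge0 ?(ltW lk) //.
  by apply: (le_trans (main _ _ lk hk hl)); exact: ler_norm.
- rewrite distrC ler0_norm ?lerz0 ?subr_le0 ?(ltW kl) //.
  rewrite -mulrNz opprB.
  by apply: (le_trans (main _ _ kl hl hk)); exact: ler_norm.
- by rewrite !subrr !normr0 mulr0.
Qed.

(** The imaginary parts tend to infinity, so only finitely many exponents come
    near z. *)
Lemma exponents_separated (mu : int -> R[i]) (g : R) N (z : R[i]) (P : pred int) :
  0 < g -> (forall k : int, (N <= `|k|)%N -> g * `|k%:~R| <= `|Imz (mu k)|) ->
  (forall k, P k -> mu k != z) ->
  exists2 d : R, 0 < d & forall k, P k -> d <= normc (mu k - z).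
Proof.
move=> g0 hlin hP.
pose X := (normc z + 1) / g; pose M := maxn N (Num.truncn X).+1.
have XM : X <= M%:R.
  by rewrite (le_trans (ltW (truncnS_gt X))) // ler_nat leq_maxr.
pose l := [seq k <- map Posz (iota 0 M) ++ map Negz (iota 0 M) | P k].
have [d d0 hd] : exists2 d : R, 0 < d & forall k, k \in l -> d <= normc (mu k - z).
  apply: exists_lower_bound_seq => k; rewrite mem_filter => /andP[/hP kz _].
  by apply: normc_gt0; rewrite subr_eq0.
exists (Num.min d 1); first by rewrite lt_min d0 ltr01.
move=> k Pk; have [kM|kM] := leqP M `|k|%N.
  rewrite ge_min; apply/orP; right.
  apply: (le_trans _ (Im_le_normc _)); rewrite cImD cImN.
  apply: (le_trans _ (lerB_dist _ _)).
  have h1 := hlin k (leq_trans (leq_maxl _ _) kM).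
  have h2 := Im_le_normc z.
  have h3 : X <= `|k%:~R|.
    by rewrite (le_trans XM) // -intr_norm -natr_absz ler_nat.
  move: h3; rewrite /X ler_pdivrMr // => h3.
  rewrite mulrC in h3; lra.
rewrite ge_min hd // mem_filter Pk mem_cat /=.
case: k kM {Pk} => n nM.
  rewrite mem_map; last by move=> ? ? [].
  by rewrite mem_iota /= add0n (nM : (n < M)%N).
apply/orP; right; rewrite mem_map; last by move=> ? ? [].
by rewrite mem_iota /= add0n; exact: ltnW.
Qed.

Lemma frame_above_inl (mu : int + nat -> R[i]) (T0 : R) (D : pred int) :
  frame_above T0 (mu \o inl) D ->
  frame_above T0 mu (fun i => if i is inl k then D k else false).
Proof.
have tr s : all (fun i : int + nat => if i is inl k then D k else false) s ->
    exists2 s' : seq int, s = map inl s' & all D s'.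
  elim: s => [|[k|n] s ih] //=; first by exists [::].
  by move=> /andP[Dk /ih[s' -> Ds']]; exists (k :: s') => //=; rewrite Dk.
have en (a b : R) s' x : energy a b mu (map inl s') x =
    energy a b (mu \o inl) s' (x \o inl).
  by apply: eq_segint => t; rewrite /expsum big_map.
move=> [[A hA] hI hD]; split.
- by exists A => -[k /hA|].
- move=> T /hI[K K0 hK]; exists K => // s x us /tr[s' ss' Ds'].
  move: us; rewrite ss' map_inj_uniq => [us'|]; last by move=> ? ? [].
  by rewrite big_map en; exact: hK.
- move=> T /hD[K K0 hK]; exists K => // s x us /tr[s' ss' Ds'].
  move: us; rewrite ss' map_inj_uniq => [us'|]; last by move=> ? ? [].
  by rewrite big_map en; exact: (hK s' (x \o inl)).
Qed.

Lemma tail_frame omega rho (g beta T0 : R) N : 0 < g -> 0 < T0 ->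
  4 * beta ^+ 2 + (pi / T0) ^+ 2 < g ^+ 2 / 4 ->
  (forall k : int, (N <= `|k|)%N -> 0 <= Imz (freqZ omega k) <= beta) ->
  (forall k l : int, (N <= `|k|)%N -> (N <= `|l|)%N ->
        g * `|(k - l)%:~R| <= `|Rez (freqZ omega k) - Rez (freqZ omega l)|) ->
  frame_above T0 (exponent omega rho)
    (fun i => if i is inl k then (N < `|k|)%N else false).
Proof.
move=> g0 T00 hq hb hg.
have hb' (k : int) : (N < `|k|)%N -> 0 <= Imz (freqZ omega k) <= beta.
  by move=> /ltnW; exact: hb.
have hg' (k l : int) : (N < `|k|)%N -> (N < `|l|)%N ->
    g * `|(k - l)%:~R| <= `|Rez (freqZ omega k) - Rez (freqZ omega l)|.
  by move=> /ltnW hk /ltnW hl; exact: hg.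
have q' : 4 * beta ^+ 2 < g ^+ 2 / 4.
  by apply: le_lt_trans hq; rewrite lerDl sqr_ge0.
apply: (frame_above_inl (D := fun k : int => (N < `|k|)%N)).
pose mu k := - Imz (freqZ omega k) +i* Rez (freqZ omega k).
have muE (k : int) : (N < `|k|)%N -> (exponent omega rho \o inl) k = mu k.
  by move=> kN /=; case: eqVneq kN => [->|] // _ _; rewrite iE.
have en (a b : R) (s : seq int) x : all (fun k : int => (N < `|k|)%N) s ->
    energy a b (exponent omega rho \o inl) s x = energy a b mu s x.
  move=> /allP sN; apply: eq_segint => t; congr (normc _ ^+ 2).
  by apply: eq_big_seq => k ks; rewrite muE // sN.
split.
- exists beta => k kN; rewrite muE //= normrN ger0_norm.
    by have /andP[] := hb' _ kN.
  by have /andP[] := hb' _ kN.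
- move=> T T0T; have T_0 : 0 < T by apply: lt_trans T0T.
  have hq' : 4 * beta ^+ 2 + (pi / T) ^+ 2 < g ^+ 2 / 4.
    apply: le_lt_trans hq; rewrite lerD2l ler_pXn2r ?nnegrE ?divr_ge0 ?pi_ge0 ?ltW //.
    by rewrite ltr_pM2l ?pi_gt0 // ltf_pV2.
  have [K K0 hK] := inverse_inequality_tail g0 hb' hg' T_0 hq'.
  by exists K => // s x us Ds; rewrite en //; exact: hK.
- move=> T T_0; have [K K0 hK] := direct_inequality_tail g0 hb' hg' T_0 q'.
  by exists K => // s x us Ds; rewrite en //; exact: hK.
Qed.

End Exponents.

(** * Blocks of the series as exponential sums *)

Section Blocks.
Variables (R : realType) (omega : nat -> R[i]) (rho : nat -> R).

(** The constants of all terms are grouped at the single index inl 0. *)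
Definition block_index (m n : nat) : seq (int + nat) :=
  [seq inl k%:Z | k <- index_iota m n] ++
  [seq inl (- k%:Z) | k <- index_iota m n] ++
  inl 0 :: [seq inr k | k <- index_iota m n].

Definition block_coef (c : nat -> R[i]) (r1 r2 : nat -> R) (m n : nat)
    (i : int + nat) : R[i] :=
  match i with
  | inl (Posz k) => if k == 0%N then (\sum_(m <= j < n) r1 j)%:C else c k
  | inl (Negz k) => (c k.+1)^*%C
  | inr k => (r2 k)%:C
  end.

Lemma summand_continuous (c : nat -> R[i]) (r1 r2 : nat -> R) k :
  continuous (fun t => Rez (summand omega rho c r1 r2 k t)).
Proof.
rewrite (_ : (fun t => _) =
  ((fun t => Rez (c k * cexp ('i%C * omega k * t%:C))) \+
   (fun t => Rez ((c k)^*%C * cexp (- 'i%C * (omega k)^*%C * t%:C)))) \+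
  (cst (r1 k) \+ (fun t => Rez ((r2 k)%:C * cexp ((rho k)%:C * t%:C))))).
  by move=> t; apply: continuousD; apply: continuousD;
    try exact: Re_cexp_continuous; exact: cst_continuous.
apply/funext => t.
transitivity (Rez (c k * cexp ('i%C * omega k * t%:C)) +
  Rez ((c k)^*%C * cexp (- 'i%C * (omega k)^*%C * t%:C)) +
  (r1 k + Rez ((r2 k)%:C * cexp ((rho k)%:C * t%:C)))); last by [].
by rewrite /summand !cReD -(rmorphM (real_complex R)) cexp_real cReZ !addrA.
Qed.

Lemma block_index_uniq m n : (0 < m)%N -> uniq (block_index m n).
Proof.
move=> m0.
have pos k : k \in index_iota m n -> (0 < k)%N.
  by rewrite mem_index_iota => /andP[/(leq_trans m0)].
rewrite /block_index !cat_uniq /= !map_inj_uniq ?iota_uniq /=;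
  try by move=> i j []; lia.
rewrite andbT; apply/and3P; split.
- rewrite has_cat /=; apply/norP; split.
    apply/hasPn => _ /mapP[k /pos k0 ->]; apply/mapP => -[j /pos j0 []]; lia.
  apply/norP; split; first by apply/mapP => -[j /pos j0 []]; lia.
  by apply/hasPn => _ /mapP[k _ ->]; apply/mapP => -[j _].
- apply/norP; split; first by apply/mapP => -[j /pos j0 []]; lia.
  by apply/hasPn => _ /mapP[k _ ->]; apply/mapP => -[j _].
- by apply/mapP => -[j].
Qed.

Lemma block_coefN (c : nat -> R[i]) (r1 r2 : nat -> R) m n k : (0 < k)%N ->
  block_coef c r1 r2 m n (inl (- k%:Z)) = (c k)^*%C.
Proof. by case: k => // k _; rewrite -NegzE. Qed.

Lemma block_coefP (c : nat -> R[i]) (r1 r2 : nat -> R) m n k : (0 < k)%N ->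
  block_coef c r1 r2 m n (inl k%:Z) = c k.
Proof. by case: k. Qed.

Lemma expsum_block (c : nat -> R[i]) (r1 r2 : nat -> R) m n t : (0 < m)%N ->
  expsum (exponent omega rho) (block_index m n) (block_coef c r1 r2 m n) t =
  \sum_(m <= k < n) summand omega rho c r1 r2 k t.
Proof.
move=> m0; rewrite /expsum /block_index !big_cat big_cons !big_map.
have -> : block_coef c r1 r2 m n (inl 0) *
    cexp (exponent omega rho (inl 0) * t%:C) = \sum_(m <= j < n) (r1 j)%:C.
  by rewrite /= mul0r cexp0 mulr1 (rmorph_sum (real_complex R)).
have XP k := block_coefP c r1 r2 m n (k := k).
have XN k := block_coefN c r1 r2 m n (k := k).
have XR k : block_coef c r1 r2 m n (inr k) = (r2 k)%:C by [].
have eP k : (0 < k)%N -> exponent omega rho (inl k%:Z) = 'i%C * omega k.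
  by case: k.
have eN k : (0 < k)%N ->
    exponent omega rho (inl (- k%:Z)) = - 'i%C * (omega k)^*%C.
  by case: k => // k _; rewrite -NegzE /= mulrN mulNr.
have eR k : exponent omega rho (inr k) = (rho k)%:C by [].
move: (block_coef c r1 r2 m n) (exponent omega rho) XP XN XR eP eN eR => X e.
move=> XP XN XR eP eN eR /=; rewrite -!big_split /=.
apply: eq_big_seq => k; rewrite mem_index_iota => /andP[mk _].
have k0 := leq_trans m0 mk.
rewrite XN // XP // XR eP // eN // eR /summand.
by rewrite -(rmorphM (real_complex R)) cexp_real (rmorphM (real_complex R)) !addrA.
Qed.

Lemma energy_block (c : nat -> R[i]) (r1 r2 : nat -> R) m n (a b : R) :
  (0 < m)%N ->
  energy a b (exponent omega rho) (block_index m n) (block_coef c r1 r2 m n) =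
  segint a b (fun t => (\sum_(m <= k < n)
    Rez (summand omega rho c r1 r2 k t)) ^+ 2).
Proof.
move=> m0; apply: eq_segint => t; rewrite expsum_block //.
have -> : \sum_(m <= k < n) summand omega rho c r1 r2 k t =
    (\sum_(m <= k < n) Rez (summand omega rho c r1 r2 k t))%:C.
  by rewrite (rmorph_sum (real_complex R)); apply: eq_bigr => k _; exact: summand_real.
by rewrite normc_real real_normK ?num_real.
Qed.

End Blocks.

(** * Direct and inverse inequalities for the series *)

Section Absorption.

(** The contribution of e3 is at most half of X W, and is absorbed in the left
    hand side. *)
Lemma absorb_half (R : realType) (A K C e e1 e2 e3 T E S X q W : R) :
  0 < K -> 0 < X -> 0 < q -> 0 <= W -> 0 <= T -> 0 <= E -> 0 <= S ->
  2 * (2 * K * T * E * S) <= q ->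
  X * W <= A -> A <= K * e1 -> e1 <= 2 * e2 + 2 * e3 -> e2 <= C * e ->
  e3 <= T * (E * (X / q * (S * W))) ->
  W <= 4 * K * C / X * e.
Proof.
move=> K0 X0 q0 W0 T0 E0 S0 hq h1 h2 h3 h4 h5.
have h6 : X * W <= K * (2 * (C * e) + 2 * (T * (E * (X / q * (S * W))))).
  apply: (le_trans h1); apply: (le_trans h2); rewrite ler_pM2l //.
  by apply: (le_trans h3); apply: lerD; rewrite ler_pM2l.
have h7 : K * (2 * (T * (E * (X / q * (S * W))))) <= X * W / 2.
  rewrite (_ : K * _ = X * W * ((2 * K * T * E * S) / q)); last first.
    by field; rewrite lt0r_neq0.
  apply: ler_wpM2l; first by rewrite mulr_ge0 // ltW.
  by rewrite ler_pdivrMr //; lra.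
rewrite mulrAC ler_pdivlMr //; lra.
Qed.

End Absorption.

Section BlockInequalities.
Variables (R : realType) (omega : nat -> R[i]) (rho : nat -> R).
Variables (alpha_rho g T0 T nu M : R) (N : nat).
Hypothesis g0 : 0 < g.
Hypothesis T00 : 0 < T0.
Hypothesis T0T : T0 < T.
Hypothesis growth : forall k : int, (N <= `|k|)%N ->
  g * `|k%:~R| <= `|Rez (freqZ omega k)|.
Hypothesis frame0 : frame_above T0 (exponent omega rho)
  (fun i => if i is inl k then (N < `|k|)%N else false).
Hypothesis Re_neq0 : forall k : int, k != 0 -> Rez (freqZ omega k) != 0.
Hypothesis exponent_inj :
  {in (fun i => if i is inr n then (0 < n)%N else true) &,
    injective (exponent omega rho)}.
Hypothesis lim_rho : rho n @[n --> \oo] --> alpha_rho.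
Hypothesis nu_gt : 1 / 2 < nu.
Hypothesis M0 : 0 < M.

Let mu := exponent omega rho.

Lemma exponent_growth (k : int) : (N.+1 <= `|k|)%N ->
  g * `|k%:~R| <= `|Imz (mu (inl k))|.
Proof.
move=> kN; rewrite /mu /=; case: eqVneq kN => [->//|k0 kN].
by rewrite iE /=; apply: growth; exact: ltnW.
Qed.

Definition low_index (K : nat) (i : int + nat) : bool :=
  if i is inr n then (0 < n <= K)%N else true.

(** Beyond the high frequencies only finitely many exponents are added. The
    remaining rho n cannot be treated in this way, since they accumulate at
    alpha_rho. *)
Lemma frame_low_index K : frame_above T0 mu (low_index K).
Proof.
pose l : seq (int + nat) := [seq inl k%:Z | k <- iota 0 N.+1] ++
  [seq inl (Negz k) | k <- iota 0 N] ++ [seq inr k | k <- iota 1 K].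
have lP i : i \in l -> match i with inl k => (`|k| <= N)%N
    | inr n => (0 < n <= K)%N end.
  rewrite !mem_cat => /or3P[] /mapP[k]; rewrite mem_iota => hk ->; lia.
apply: (eq_frame_above _ (frame_above_adds (ltW T00) (l := l) _ _ frame0)).
- move=> [k|n] /=; last first.
    rewrite /l !mem_cat; apply/idP/idP.
      by move=> /or3P[] /mapP[j] // + [->]; rewrite mem_iota; lia.
    by move=> nK; apply/or3P/Or33/mapP; exists n; rewrite // mem_iota add1n ltnS.
  case: ltnP => //= kN; rewrite /l !mem_cat.
  case: k kN => j jN; apply/or3P; [apply: Or31|apply: Or32]; apply/mapP;
    exists j => //; rewrite mem_iota; lia.
- move=> i /lP il.
  have sep (k : int) : (N < `|k|)%N -> (mu \o inl) k != mu i.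
    move=> kN; apply/eqP => /exponent_inj; rewrite !unfold_in => e.
    have ki : inl k = i by apply: e => //; case: i il => // n /andP[].
    by move: il; rewrite -ki leqNgt kN.
  have [d d0 hd] := exponents_separated g0 exponent_growth sep.
  by exists d => // -[k|n] //; exact: hd.
- move=> i j /lP il /lP jl; apply: exponent_inj; rewrite unfold_in.
    by case: i il => // n /andP[].
  by case: j jl => // n /andP[].
Qed.

Lemma remainder_bound : exists2 S : R, 0 < S & forall (c : nat -> R[i])
  (r1 r2 : nat -> R) (m n : nat), (0 < m)%N ->
  (forall n : nat, (1 <= n)%N ->
         `|r1 n| + `|r2 n| <= M / (n%:R `^ nu) * Normc.normc (c n)) ->
  (\sum_(m <= k < n) (`|r1 k| + `|r2 k|)) ^+ 2 <=
  S * \sum_(m <= k < n) normc (c k) ^+ 2.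
Proof.
have [S S0 hS] := p_series_bounded nu_gt.
exists (M ^+ 2 * S); first by rewrite mulr_gt0 ?exprn_gt0.
move=> c r1 r2 m n m0 hr.
have h0 : 0 <= \sum_(m <= k < n) (`|r1 k| + `|r2 k|).
  by apply: sumr_ge0 => k _; rewrite addr_ge0.
have h1 : \sum_(m <= k < n) (`|r1 k| + `|r2 k|) <=
    \sum_(m <= k < n) (M / (k%:R `^ nu)) * normc (c k).
  by apply: ler_sum_nat => k /andP[mk _]; apply: hr; exact: leq_trans mk.
apply: (@le_trans _ _ ((\sum_(m <= k < n) (M / (k%:R `^ nu)) * normc (c k)) ^+ 2)).
  by rewrite ler_pXn2r ?nnegrE // (le_trans h0).
apply: le_trans (cauchy_schwarz_sum _ _ _) _.
apply: ler_wpM2r; first by apply: sumr_ge0 => k _; exact: sqr_ge0.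
under eq_bigr do rewrite exprMn exprVn.
by rewrite -mulr_sumr ler_pM2l ?exprn_gt0 // hS.
Qed.

Lemma expsum_remainder_le (A : R) (c : nat -> R[i]) (r1 r2 : nat -> R) m n t :
  0 <= A -> (forall n, `|rho n| <= A) -> 0 <= t <= T ->
  normc (expsum mu (inl 0 :: [seq inr k | k <- index_iota m n])
    (block_coef c r1 r2 m n) t) <=
  expR (A * T) * \sum_(m <= k < n) (`|r1 k| + `|r2 k|).
Proof.
move=> A0 hA /andP[t0 tT].
have E1 : 1 <= expR (A * T).
  by rewrite -expR0 ler_expR mulr_ge0 // (le_trans t0).
rewrite /expsum big_cons big_map; apply: (le_trans (le_normcD _ _)).
rewrite big_split mulrDr; apply: lerD.
  rewrite (_ : mu (inl 0) = 0) // mul0r cexp0 mulr1 normc_real.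
  apply: (le_trans (ler_norm_sum _ _ _)); rewrite ler_peMl //.
  by apply: sumr_ge0.
apply: (le_trans (le_normc_sum _ _)); rewrite mulr_sumr; apply: ler_sum => k _.
rewrite Normc.normcM normc_real mulrC; apply: ler_wpM2r => //.
rewrite -(rmorphM (real_complex R)) normc_cexp /= ler_expR.
have := hA k; have := ler_norm (rho k); nra.
Qed.

(** The terms with r1 and r2 are bounded uniformly on [0, T], by summability
    of n^(- 2 nu). *)
Lemma block_direct_inequality : exists2 B : R, 0 < B &
  forall (c : nat -> R[i]) (r1 r2 : nat -> R) (m n : nat), (0 < m)%N ->
  (forall n : nat, (1 <= n)%N ->
         `|r1 n| + `|r2 n| <= M / (n%:R `^ nu) * Normc.normc (c n)) ->
  energy 0 T mu (block_index m n) (block_coef c r1 r2 m n) <=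
  B * \sum_(m <= k < n) normc (c k) ^+ 2.
Proof.
have T_0 : 0 < T by exact: lt_trans T0T.
have [_ _ /(_ T T_0)[B B0 hB]] := frame_low_index 0.
have [A A0 hA] := exists_upper_bound_near lim_rho.
have [S S0 hS] := remainder_bound.
pose Q := expR (A * T) ^+ 2 * S * T.
have Q0 : 0 < Q by rewrite mulr_gt0 // mulr_gt0 // exprn_gt0 ?expR_gt0.
exists (2 * (B * 2) + 2 * Q); first by rewrite addr_gt0 // mulr_gt0 // mulr_gt0.
move=> c r1 r2 m n m0 hr; set x := block_coef c r1 r2 m n.
set C := \sum_(m <= k < n) normc (c k) ^+ 2.
have us := block_index_uniq n m0.
pose s1 : seq (int + nat) := [seq inl k%:Z | k <- index_iota m n] ++
  [seq inl (- k%:Z) | k <- index_iota m n].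
pose s2 : seq (int + nat) := inl 0 :: [seq inr k | k <- index_iota m n].
have sE : block_index m n = s1 ++ s2 by rewrite /block_index -catA.
have us1 : uniq s1 by move: us; rewrite sE cat_uniq => /andP[].
have s1low : all (low_index 0) s1.
  by rewrite all_cat !all_map; apply/andP; split; apply/allP.
have := hB s1 x us1 s1low.
have -> : \sum_(i <- s1) normc (x i) ^+ 2 = 2 * C.
  rewrite mulr2n mulrDl mul1r /s1 big_cat !big_map; congr (_ + _);
    apply: eq_big_seq => k; rewrite mem_index_iota => /andP[mk _].
    by rewrite /x block_coefP // (leq_trans m0).
  by rewrite /x block_coefN ?normc_conj // (leq_trans m0).
move=> h1.
have h2 : energy 0 T mu s2 x <= Q * C.
  rewrite /Q mulrAC -[X in _ <= _ * X](subr0 T).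
  apply: energy_le_cst => [|t tT]; first exact: ltW.
  have := expsum_remainder_le c r1 r2 m n (ltW A0) hA tT.
  rewrite -/s2 -/x => h.
  apply: (@le_trans _ _ ((expR (A * T) * \sum_(m <= k < n) (`|r1 k| + `|r2 k|)) ^+ 2)).
    by rewrite ler_pXn2r ?nnegrE ?normc_ge0 // (le_trans _ h) // normc_ge0.
  by rewrite exprMn -[leRHS]mulrA ler_pM2l ?exprn_gt0 ?expR_gt0 // hS.
rewrite mulrDl.
apply: (le_trans (energy_le2 0 T (s1 := s1) (x1 := x) (s2 := s2) (x2 := x) _)).
  by move=> t; rewrite sE /expsum big_cat.
by apply: lerD; rewrite -[leRHS]mulrA ler_pM2l // -[leRHS]mulrA.
Qed.

Lemma rho_multiplier_le (dl : R) k : `|(rho k - alpha_rho) * dl| <= 1 / 2 ->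
  normc (1 - cexp_mean ((mu (inr k) - alpha_rho%:C) * dl%:C)) <=
  2 * `|(rho k - alpha_rho) * dl|.
Proof.
move=> h; have := cexp_mean_real_upper h.
by rewrite (rmorphM (real_complex R)) (rmorphB (real_complex R)).
Qed.

(** Averaging with the exponent alpha_rho is applied p times, with intervals
    of total length T - T1. It multiplies the coefficients of the frequencies
    by at least m0^p and those of the rho k, k > K, by at most (m0 / 2)^p. As
    K does not depend on the length of the averaging intervals, and the
    constant K1 of the inequality for the other exponents does not depend on
    p, a large p makes the terms with rho k, k > K, small compared with the
    coefficients c that dominate them. *)
Lemma block_inverse_inequality : exists2 B : R, 0 < B &
  forall (c : nat -> R[i]) (r1 r2 : nat -> R) (n : nat),
  (forall n : nat, (1 <= n)%N ->
         `|r1 n| + `|r2 n| <= M / (n%:R `^ nu) * Normc.normc (c n)) ->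
  \sum_(1 <= k < n) normc (c k) ^+ 2 <=
  B * energy 0 T mu (block_index 1 n) (block_coef c r1 r2 1 n).
Proof.
have T_0 : 0 < T by exact: lt_trans T0T.
pose T1 := (T0 + T) / 2.
have T01 : T0 < T1 by rewrite /T1; move: T0T; lra.
have T1T : T1 < T by rewrite /T1; move: T0T; lra.
have T1_0 : 0 < T1 by exact: lt_trans T01.
have [eps [c0 [eps0 c00 hc]]] := cexp_mean_lower R.
have sep k : k != 0 -> (mu \o inl) k != alpha_rho%:C.
  move=> k0; rewrite /mu /= (negbTE k0) iE; apply/eqP => -[_ e].
  by have := Re_neq0 k0; rewrite e eqxx.
have [d d0 hd] := exponents_separated g0 exponent_growth sep.
have cd0 : 0 < c0 * d / 4 by rewrite divr_gt0 ?mulr_gt0.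
(* Beyond K the multiplier of rho k is at most half of the lower bound m0
   below, for every length dl <= dlmax of the averaging interval. *)
have [K hK] := cvg_dist_near lim_rho cd0.
have [[A hA] /(_ T1 T01)[K1 K10 hK1] _] := frame_low_index K.
have [Ar Ar0 hAr] := exists_upper_bound_near lim_rho.
have [S S0 hS] := remainder_bound.
pose L := `|A| + `|alpha_rho| + 1.
have L0 : 0 < L by rewrite /L ltr_wpDl // addr_ge0.
(* For dl <= dlmax the arguments of the multipliers lie in the strip of
   cexp_mean_lower, dl d is at most 1, and the arguments at the rho k, k > K,
   are at most 1 / 2. *)
pose dlmax := Num.min (eps / L) (Num.min d^-1 (c0 * d / 4)^-1 / 2).
have dm0 : 0 < dlmax.
  by rewrite lt_min !divr_gt0 //= lt_min !invr_gt0 d0.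
pose Q := 2 * K1 * T * expR (Ar * T) ^+ 2 * S.
have E20 : 0 < expR (Ar * T) ^+ 2 by rewrite exprn_gt0 // expR_gt0.
have Q0 : 0 < Q.
  by rewrite /Q; do 4! (apply: mulr_gt0 => //).
(* 4^p > p >= 2 Q makes the remainder absorbable, and the second bound
   makes the averaging intervals shorter than dlmax. *)
pose p := maxn (Num.truncn (2 * Q)).+1 (Num.truncn ((T - T1) / dlmax)).+1.
have p0 : 0 < p%:R :> R by rewrite ltr0n /p leq_max.
have pQ : 2 * Q <= 4 ^+ p.
  apply: (le_trans (ltW (truncnS_gt _))); rewrite -natrX ler_nat.
  by apply: (leq_trans (leq_maxl _ _)); apply: ltnW; exact: ltn_expl.
pose dl := (T - T1) / p%:R.
have dl0 : 0 < dl by rewrite divr_gt0 ?subr_gt0.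
have dlm : dl <= dlmax.
  rewrite ler_pdivrMr // mulrC -ler_pdivrMr //.
  apply: (le_trans (ltW (truncnS_gt _))); rewrite ler_nat; exact: leq_maxr.
have dlp : dl * p%:R = T - T1 by rewrite divfK // lt0r_neq0.
have dlL : dl * L <= eps.
  by rewrite -ler_pdivlMr // (le_trans dlm) // ge_min lexx.
have dld : dl * d <= 1.
  rewrite -ler_pdivlMr // div1r (le_trans dlm) // ge_min; apply/orP; right.
  rewrite ler_pdivrMr // (le_trans (_ : _ <= d^-1)) ?ge_min ?lexx //.
  by rewrite ler_peMr ?invr_ge0 ?ler1n // ltW.
have dlc : dl * (c0 * d / 4) <= 1 / 2.
  rewrite -ler_pdivlMr // (le_trans dlm) // ge_min; apply/orP; right.
  by rewrite div1r mulrC ler_pM2l ?invr_gt0 // ge_min lexx orbT.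
pose m0 := c0 * (dl * d).
have m00 : 0 < m0 by rewrite mulr_gt0 // mulr_gt0.
pose mult i := 1 - cexp_mean ((mu i - alpha_rho%:C) * dl%:C).
have mult_low k : k != 0 -> m0 <= normc (mult (inl k)).
  move=> k0; apply: le_trans (hc _ _); last first.
    rewrite Re_mulr_real normrM (gtr0_norm dl0) mulrC; apply: le_trans dlL.
    rewrite ler_pM2l // cReD cReN (le_trans (ler_normB _ _)) // /L /=.
    apply: ler_wpDr => //; apply: lerD => //.
    exact: le_trans (hA (inl k) isT) (ler_norm _).
  rewrite /m0 ler_pM2l // le_min dld Normc.normcM normc_real (gtr0_norm dl0) mulrC.
  by rewrite ler_pM2r // hd.
have mult_up k : (K < k)%N -> normc (mult (inr k)) <= m0 / 2.
  move=> Kk; have h := hK k (ltnW Kk).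
  have h' : `|(rho k - alpha_rho) * dl| <= dl * (c0 * d / 4).
    by rewrite normrM (gtr0_norm dl0) mulrC ler_pM2l.
  apply: (le_trans (rho_multiplier_le (le_trans h' dlc))).
  apply: (le_trans (_ : _ <= 2 * (dl * (c0 * d / 4)))); first by rewrite ler_pM2l.
  by rewrite le_eqVlt; apply/orP; left; apply/eqP; rewrite /m0; field.
set C1 := 2 + 2 * (expR (2 * `|Rez alpha_rho%:C| * dl) / dl) * T.
have C10 : 0 < C1.
  by rewrite /C1 addr_gt0 // mulr_gt0 // mulr_gt0 // divr_gt0 // expR_gt0.
pose B := 4 * K1 * C1 ^+ p / m0 ^+ (2 * p).
exists B; first by rewrite divr_gt0 ?exprn_gt0 // mulr_gt0 ?exprn_gt0 // mulr_gt0.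
move=> c r1 r2 n hr; set s := block_index 1 n; set x := block_coef c r1 r2 1 n.
set CC := \sum_(1 <= k < n) normc (c k) ^+ 2.
set e := energy 0 T mu s x.
pose y i := x i * mult i ^+ p.
pose P := low_index K.
pose s1 := [seq i <- s | P i]; pose s2 := [seq i <- s | ~~ P i].
have us : uniq s by exact: block_index_uniq.
have CC0 : 0 <= CC by apply: sumr_ge0 => k _; exact: sqr_ge0.
have h1 : \sum_(i <- s1) normc (y i) ^+ 2 <= K1 * energy 0 T1 mu s1 y.
  by apply: hK1; [exact: filter_uniq|exact: filter_all].
have h2 : energy 0 T1 mu s1 y <= 2 * energy 0 T1 mu s y + 2 * energy 0 T1 mu s2 y.
  exact: energy_filter_le.
have h3 : energy 0 T1 mu s y <= C1 ^+ p * e.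
  have := @deflate_iter_energy R _ alpha_rho%:C dl T mu s x p dl0.
  rewrite dlp; have -> : T - (T - T1) = T1 by ring.
  by move: dlp T1_0 => /= e1 e2; apply; rewrite gerBl ltW.
(* Only the rho k with k > K are left in s2, each with a multiplier at most
   m0 / 2. *)
have h4 : energy 0 T1 mu s2 y <=
    T * (expR (Ar * T) ^+ 2 * ((m0 / 2) ^+ (2 * p) * (S * CC))).
  set k := _ * ((m0 / 2) ^+ _ * _).
  have k0 : 0 <= k.
    apply: mulr_ge0; first exact: ltW.
    apply: mulr_ge0; first by rewrite exprn_ge0 // divr_ge0 // ltW.
    by apply: mulr_ge0 => //; exact: ltW.
  apply: (@le_trans _ _ (k * (T1 - 0))); last first.
    by rewrite subr0 mulrC; apply: ler_wpM2r => //; exact: ltW.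
  apply: energy_le_cst; first exact: ltW.
  move=> t /andP[t0 tT1].
  pose F (i : int + nat) := if i is inr k then
    `|r2 k| * (m0 / 2) ^+ p * expR (Ar * T) else 0.
  have F0 i : 0 <= F i.
    case: i => //= k1; rewrite mulr_ge0 ?expR_ge0 // mulr_ge0 // exprn_ge0 //.
    by rewrite divr_ge0 // ltW.
  have s2P i : i \in s2 ->
      exists2 k, i = inr k & (k \in index_iota 1 n) && (K < k)%N.
    rewrite mem_filter => /andP[nP]; rewrite mem_cat mem_cat inE.
    case/or4P => [/mapP[j _ ij]|/mapP[j _ ij]|/eqP ij|/mapP[j hj ij]];
      move: nP; rewrite /P ij //= => nP.
    exists j => //; rewrite hj; move: hj; rewrite mem_index_iota => /andP[j1 _].
    by move: nP; rewrite j1 /= -ltnNge.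
  have nle : normc (expsum mu s2 y t) <=
      expR (Ar * T) * ((m0 / 2) ^+ p * \sum_(1 <= k < n) (`|r1 k| + `|r2 k|)).
    apply: (le_trans (le_normc_sum _ _)).
    apply: (@le_trans _ _ (\sum_(i <- s2) F i)).
      rewrite big_seq [leRHS]big_seq; apply: ler_sum => i /s2P[j -> /andP[hj Kj]].
      rewrite 2!Normc.normcM (_ : x (inr j) = (r2 j)%:C) // normc_real /F.
      apply: ler_pM; rewrite ?mulr_ge0 ?normc_ge0 //.
        apply: ler_wpM2l => //.
        have -> : normc (mult (inr j) ^+ p) = normc (mult (inr j)) ^+ p.
          elim: (p) => [|q ih]; first by rewrite !expr0 Normc.normc1.
          by rewrite !exprS Normc.normcM ih.
        apply: lerXn2r; rewrite ?nnegrE ?normc_ge0 //; last exact: mult_up.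
        by rewrite divr_ge0 // ltW.
      rewrite -(rmorphM (real_complex R)) normc_cexp /= ler_expR.
      apply: (le_trans (ler_norm _)); rewrite normrM (ger0_norm t0).
      by apply: ler_pM => //; exact: le_trans tT1 (ltW T1T).
    apply: (@le_trans _ _ (\sum_(i <- [seq inr k | k <- index_iota 1 n]) F i)).
      apply: ler_uniq_sum => //; first exact: filter_uniq.
        by rewrite map_inj_uniq ?iota_uniq // => i j [].
      move=> i /s2P[j -> /andP[hj _]]; exact: map_f.
    rewrite big_map !mulr_sumr; apply: ler_sum => j _ /=.
    rewrite mulrC; apply: ler_wpM2l; first exact: expR_ge0.
    rewrite mulrC; apply: ler_wpM2l; first by rewrite exprn_ge0 // divr_ge0 // ltW.
    by rewrite lerDr.
  apply: (@le_trans _ _ ((expR (Ar * T) *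
      ((m0 / 2) ^+ p * \sum_(1 <= k < n) (`|r1 k| + `|r2 k|))) ^+ 2)).
    by rewrite ler_pXn2r ?nnegrE ?normc_ge0 // (le_trans _ nle) // normc_ge0.
  rewrite /k exprMn ler_pM2l ?exprn_gt0 ?expR_gt0 // exprMn -exprM mulnC.
  by rewrite ler_pM2l ?exprn_gt0 ?divr_gt0 // hS.
(* The frequencies of positive index alone carry all the c k. *)
have h5 : m0 ^+ (2 * p) * CC <= \sum_(i <- s1) normc (y i) ^+ 2.
  apply: (@le_trans _ _ (\sum_(i <- [seq inl k%:Z | k <- index_iota 1 n])
      normc (y i) ^+ 2)).
    rewrite big_map mulr_sumr; apply: ler_sum_nat => k /andP[k0 _].
    rewrite /y /x block_coefP // Normc.normcM [leRHS]exprMn [leLHS]mulrC.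
    rewrite ler_wpM2l ?sqr_ge0 //.
    have -> : normc (mult (inl k%:Z) ^+ p) = normc (mult (inl k%:Z)) ^+ p.
      elim: (p) => [|q ih]; first by rewrite !expr0 Normc.normc1.
      by rewrite !exprS Normc.normcM ih.
    rewrite -exprM mulnC; apply: lerXn2r; rewrite ?nnegrE ?normc_ge0 ?(ltW m00) //.
    by rewrite mult_low // eqz_nat -lt0n.
  apply: ler_uniq_sum.
  - by rewrite map_inj_uniq ?iota_uniq // => i j [].
  - exact: filter_uniq.
  - by move=> _ /mapP[k hk ->]; rewrite mem_filter /= mem_cat map_f.
  - by move=> i; exact: sqr_ge0.
have m2p : 0 < m0 ^+ (2 * p) by rewrite exprn_gt0.
have q0 : 0 < (4 : R) ^+ p by rewrite exprn_gt0.
have e4 : (m0 / 2) ^+ (2 * p) = m0 ^+ (2 * p) / 4 ^+ p.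
  by rewrite expr_div_n (exprM 2) (_ : 2 ^+ 2 = 4 :> R) // -natrX.
rewrite e4 in h4.
exact: (absorb_half K10 m2p q0 CC0 (ltW T_0) (ltW E20) (ltW S0) pQ h5 h1 h2 h3 h4).
Qed.

End BlockInequalities.

(** * Completeness of the space of square integrable functions *)

Section L2Complete.
Variables (R : realType) (d : measure_display) (X : measurableType d).
Variables (mu : {measure set X -> \bar R}) (D : set X).
Hypothesis mD : measurable D.
Hypothesis muD : (mu D < +oo)%E.
Variable S : nat -> X -> R.
Hypothesis mS : forall n, measurable_fun D (S n).

Let msqr (f g : X -> R) : measurable_fun D f -> measurable_fun D g ->
  measurable_fun D (fun x => ((f x - g x) ^+ 2)%:E).
Proof.
move=> mf mg; apply/measurable_EFinP.
by apply: measurable_funX; exact: measurable_funB.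
Qed.

(** Along a subsequence with squared distances at most 4^(- k), the bound |d|
    <= 2^(- k) + 2^k d^2 makes the successive differences summable almost
    everywhere. The limit is written as an upper limit, which is measurable,
    and Fatou's lemma transfers the Cauchy estimate to it. *)
Lemma L2_complete :
  (forall e : R, 0 < e -> exists N, forall m n, (N <= m)%N -> (N <= n)%N ->
    (\int[mu]_(x in D) ((S m x - S n x) ^+ 2)%:E <= e%:E)%E) ->
  exists2 f : X -> R, measurable_fun D f &
    forall e : R, 0 < e -> exists N, forall n, (N <= n)%N ->
      (\int[mu]_(x in D) ((f x - S n x) ^+ 2)%:E <= e%:E)%E.
Proof.
move=> cauchy.
have /choice[Nk hNk] : forall k : nat, exists N, forall m n, (N <= m)%N ->
    (N <= n)%N -> (\int[mu]_(x in D) ((S m x - S n x) ^+ 2)%:E <=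
    ((2 ^+ k)^-1 ^+ 2)%:E)%E.
  by move=> k; apply: cauchy; rewrite exprn_gt0 // invr_gt0 exprn_gt0.
(* The index phi k is nondecreasing, beyond Nk k, and tends to infinity. *)
pose phi k := (\sum_(j < k.+1) Nk j + k)%N.
have phiN k : (Nk k <= phi k)%N.
  by rewrite /phi big_ord_recr /= -addnA addnCA leq_addr.
have phiS k : (phi k <= phi k.+1)%N.
  by rewrite /phi [X in (_ <= X + _)%N]big_ord_recr /= -addnA leq_add2l; lia.
have phik k : (k <= phi k)%N by rewrite /phi leq_addl.
pose dS k x := S (phi k.+1) x - S (phi k) x.
have mdS k : measurable_fun D (dS k) by apply: measurable_funB.
have mdSn k : measurable_fun D (fun x => `|dS k x|%:E).
  by apply/measurable_EFinP; apply: measurableT_comp.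
pose a := fine (mu D).
have aE : mu D = a%:E by rewrite /a fineK // ge0_fin_numE.
have a0 : 0 <= a by rewrite /a fine_ge0.
have dS_int k : (\int[mu]_(x in D) `|dS k x|%:E <= ((2 ^+ k)^-1 * (a + 1))%:E)%E.
  have p0 : 0 < (2 : R) ^+ k by rewrite exprn_gt0.
  have pi0 : 0 < ((2 : R) ^+ k)^-1 by rewrite invr_gt0.
  apply: (@le_trans _ _ (\int[mu]_(x in D)
      (((2 ^+ k)^-1)%:E + (2 ^+ k)%:E * (dS k x ^+ 2)%:E))%E).
    apply: ge0_le_integral => //.
    - apply: emeasurable_funD; first exact: measurable_cst.
      by apply: measurable_funeM; apply/measurable_EFinP; exact: measurable_funX.
    - move=> x _; rewrite -EFinM -EFinD lee_fin.
      have h : 0 <= (1 - 2 ^+ k * `|dS k x|) ^+ 2 by exact: sqr_ge0.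
      have e1 : `|dS k x| ^+ 2 = dS k x ^+ 2 by rewrite real_normK ?num_real.
      rewrite -(ler_pM2l p0) -e1 mulrDr mulfV ?lt0r_neq0 //.
      have := normr_ge0 (dS k x); nra.
  have msq : measurable_fun D (fun x => (dS k x ^+ 2)%:E).
    by apply/measurable_EFinP; exact: measurable_funX.
  have mksq : measurable_fun D (fun x => (2 ^+ k)%:E * (dS k x ^+ 2)%:E)%E.
    exact: measurable_funeM.
  have nsq x : D x -> (0 <= (dS k x ^+ 2)%:E)%E by rewrite lee_fin sqr_ge0.
  have nksq x : D x -> (0 <= (2 ^+ k)%:E * (dS k x ^+ 2)%:E)%E.
    by move=> Dx; rewrite mule_ge0 ?nsq // lee_fin ltW.
  have nc x : D x -> (0 <= (((2 : R) ^+ k)^-1)%:E)%E by rewrite lee_fin ltW.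
  rewrite (ge0_integralD mu mD nc) // integral_cst // aE.
  rewrite (ge0_integralZl mu mD msq nsq) ?lee_fin ?(ltW p0) //.
  rewrite mulrDr mulr1 EFinD -EFinM leeD2l //.
  have := hNk k (phi k.+1) (phi k) (leq_trans (phiN k) (phiS k)) (phiN k).
  move=> h; apply: (@le_trans _ _ ((2 ^+ k)%:E * ((2 ^+ k)^-1 ^+ 2)%:E)%E).
    by rewrite lee_pmul2l.
  by rewrite -EFinM lee_fin expr2 mulrA mulfV ?lt0r_neq0 // mul1r.
pose G x := (\sum_(k <oo) `|dS k x|%:E)%E.
have intG : (\int[mu]_(x in D) G x < +oo)%E.
  rewrite /G integral_nneseries //.
  apply: (@le_lt_trans _ _ (2 * (a + 1))%:E); last exact: ltry.
  apply: lime_le.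
    by apply: is_cvg_nneseries => k _ _; apply: integral_ge0 => x _; rewrite lee_fin.
  apply: nearW => n.
  apply: (@le_trans _ _ (\sum_(0 <= k < n) ((2 ^+ k)^-1 * (a + 1))%:E)%E).
    exact: lee_sum.
  rewrite sumEFin lee_fin -mulr_suml; apply: ler_wpM2r; first by rewrite addr_ge0.
  have -> : \sum_(0 <= k < n) ((2 : R) ^+ k)^-1 = 2 - 2 * (2 ^+ n)^-1.
    elim: n => [|n ih]; first by rewrite big_geq // expr0 invr1 mulr1 subrr.
    have : (2 : R) ^+ n != 0 by rewrite expf_neq0.
    by rewrite big_nat_recr //= ih exprS => h; field.
  by rewrite gerBl mulr_ge0 // invr_ge0 exprn_ge0.
have mG : measurable_fun D G.
  by apply: (@ge0_emeasurable_sum _ _ _ _ _ xpredT) => // k x _ _; rewrite lee_fin.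
have iG : mu.-integrable D G.
  apply/integrableP; split => //; apply: le_lt_trans intG.
  apply: ge0_le_integral => //.
  - by apply: measurableT_comp.
  - move=> x _; rewrite gee0_abs //; apply: nneseries_ge0 => k _ _.
    by rewrite lee_fin.
pose f x := fine (limn_esup (fun k => (S (phi k) x)%:E)).
have mf : measurable_fun D f.
  apply: measurableT_comp => //.
  by apply: measurable_fun_limn_esup => k; apply/measurable_EFinP.
have cvf : {ae mu, forall x, D x -> S (phi k) x @[k --> \oo] --> f x}.
  have := integrable_ae mD iG; apply: filterS => x hx Dx.
  have Gx := hx Dx.
  have cn : cvgn [normed series (dS ^~ x)].
    have nE n : [normed series (dS ^~ x)] n = \sum_(0 <= k < n) `|dS k x|.
      by rewrite /normed_series_of seriesEnat.
    apply: nondecreasing_is_cvgn.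
      by apply/nondecreasing_seqP => n; rewrite !nE big_nat_recr //= lerDl.
    exists (fine (G x)) => _ [n _ <-]; rewrite nE -lee_fin fineK //.
    rewrite -sumEFin; apply: nneseries_lim_ge => k _ _; by rewrite lee_fin.
  have /cvg_ex[l hl] := normed_cvg cn.
  have cl : S (phi k) x @[k --> \oo] --> l + S (phi 0%N) x.
    rewrite (_ : (fun k => S (phi k) x) =
        (fun k => series (dS ^~ x) k + S (phi 0%N) x)).
      by apply: cvgD => //; exact: cvg_cst.
    apply/funext => k; rewrite seriesEnat /=.
    by rewrite (telescope_sumr (fun k => S (phi k) x)) // subrK.
  have cE : (S (phi k) x)%:E @[k --> \oo] --> (l + S (phi 0%N) x)%:E.
    by apply: cvg_EFin => //; exact: nearW.
  by rewrite /f (cvg_limn_einf_sup cE).2.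
exists f => // e e0; have [N hN] := cauchy e e0.
exists N => n Nn.
have mSn k : measurable_fun D (fun x => ((S (phi k) x - S n x) ^+ 2)%:E).
  exact: msqr.
apply: (@le_trans _ _ (\int[mu]_(x in D)
    limn_einf (fun k => ((S (phi k) x - S n x) ^+ 2)%:E))%E).
  apply: ae_ge0_le_integral => //.
  - by move=> x _; rewrite lee_fin sqr_ge0.
  - exact: msqr.
  - move=> x _; rewrite limn_einf_lim; apply: lime_ge; first exact: is_cvg_einfs.
    apply: nearW => k; apply: le_ereal_inf_tmp => _ [j _ <-].
    by rewrite lee_fin sqr_ge0.
  - apply: measurableT_comp => //; apply: measurable_fun_limn_esup => k.
    exact: measurableT_comp.
  - move: cvf; apply: filterS => x hx Dx; have cx := hx Dx.
    have cE : ((S (phi k) x - S n x) ^+ 2)%:E @[k --> \oo] -->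
        ((f x - S n x) ^+ 2)%:E.
      apply: cvg_EFin; first exact: nearW.
      have c1 : S (phi k) x - S n x @[k --> \oo] --> f x - S n x.
        by apply: cvgB => //; exact: cvg_cst.
      by under eq_fun do rewrite expr2; rewrite expr2; exact: cvgM.
    by rewrite (cvg_limn_einf_sup cE).1.
apply: (@le_trans _ _ (limn_einf (fun k =>
    \int[mu]_(x in D) ((S (phi k) x - S n x) ^+ 2)%:E))%E).
  by apply: fatou => // k x _; rewrite lee_fin sqr_ge0.
rewrite limn_einf_lim; apply: lime_le; first exact: is_cvg_einfs.
apply: nearW => k.
apply: (@le_trans _ _
    (\int[mu]_(x in D) ((S (phi (maxn k N)) x - S n x) ^+ 2)%:E)%E).
  by apply: ereal_inf_lbound; exists (maxn k N) => //=; rewrite leq_maxl.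
apply: hN => //; apply: leq_trans (phik _); exact: leq_maxr.
Qed.

End L2Complete.

(** * From partial sums to the sum of the series *)

Section PartialSums.
Variable R : realType.

(** The last inequality is T0 > 2 pi / sqrt (gamma^2 - 16 alpha^2) in the form
    needed for th = pi / T0. *)
Lemma critical_time (gamma alpha T : R) : 0 < alpha -> 4 * alpha < gamma ->
  2 * pi / Num.sqrt (gamma ^+ 2 - 16 * alpha ^+ 2) < T ->
  exists T0 : R, [/\ 0 < T0, T0 < T &
    4 * alpha ^+ 2 + (pi / T0) ^+ 2 < gamma ^+ 2 / 4].
Proof.
move=> alpha0 ag; set D := gamma ^+ 2 - 16 * alpha ^+ 2 => hT.
have D0 : 0 < D.
  rewrite /D (_ : _ - _ = (gamma - 4 * alpha) * (gamma + 4 * alpha)); last by ring.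
  by rewrite mulr_gt0; lra.
have s0 : 0 < Num.sqrt D by rewrite sqrtr_gt0.
have pi0 := pi_gt0 R.
set Tc := 2 * pi / Num.sqrt D in hT.
have Tc0 : 0 < Tc by rewrite divr_gt0 // mulr_gt0.
exists ((Tc + T) / 2); split; [lra|lra|].
have : pi / ((Tc + T) / 2) < pi / Tc.
  by rewrite ltr_pM2l // ltf_pV2 ?posrE; lra.
have -> : pi / Tc = Num.sqrt D / 2.
  have key (p q : R) : p != 0 -> q != 0 -> p / (2 * p / q) = q / 2.
    by move=> p0 q0; field; rewrite p0 q0.
  by apply: key; exact: lt0r_neq0.
move=> h; have {h} : (pi / ((Tc + T) / 2)) ^+ 2 < (Num.sqrt D / 2) ^+ 2.
  have pT : 0 < pi / ((Tc + T) / 2) by apply: divr_gt0 => //; lra.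
  by rewrite ltr_pXn2r // nnegrE ?(ltW pT) // divr_ge0 // ltW.
rewrite [(Num.sqrt D / 2) ^+ 2]expr_div_n sqr_sqrtr ?(ltW D0) // {1}/D => h; lra.
Qed.

Lemma freqZ_opp (omega : nat -> R[i]) (k : int) : k != 0 ->
  freqZ omega (- k) = - (freqZ omega k)^*%C.
Proof.
case: k => [[|n]|n] k0; first by rewrite eqxx in k0.
  by rewrite -NegzE.
rewrite NegzE opprK /=; case: (omega n.+1) => a b.
by apply/eqP; rewrite eq_complex /= !opprK !eqxx.
Qed.

(** The frequencies of index n and - n differ, so no frequency is purely
    imaginary: this separates alpha_rho from the exponents i omega_k. *)
Lemma partial_sum_inequalities (omega : nat -> R[i]) (rho : nat -> R)
  (gamma alpha_omega alpha_rho nu M T : R)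
  (gamma_gt0 : 0 < gamma) (alpha_omega_gt0 : 0 < alpha_omega)
  (gap_omega : limn_einf (fun n : nat =>
     (complex.Re (omega n.+1) - complex.Re (omega n))%:E) = gamma%:E)
  (lim_Im_omega : complex.Im (omega n) @[n --> \oo] --> alpha_omega)
  (lim_rho : rho n @[n --> \oo] --> alpha_rho)
  (gamma_gt : 4 * alpha_omega < gamma)
  (omega_neq0 : forall k : int, k != 0 -> freqZ omega k != 0)
  (omega_inj : forall k l : int, k != 0 -> l != 0 -> k != l ->
     freqZ omega k != freqZ omega l)
  (rho_neq0 : forall n : nat, (1 <= n)%N -> rho n != 0)
  (rho_inj : forall m n : nat, (1 <= m)%N -> (1 <= n)%N -> m != n ->
     rho m != rho n)
  (rho_omega : forall (n : nat) (k : int), (1 <= n)%N -> k != 0 ->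
     (rho n)%:C != 'i%C * freqZ omega k)
  (nu_gt : 1 / 2 < nu) (M_gt0 : 0 < M)
  (T_gt : 2 * pi / Num.sqrt (gamma ^+ 2 - 16 * alpha_omega ^+ 2) < T) :
  0 < T /\ exists B K : R, [/\ 0 < B, 0 < K &
    forall (c : nat -> R[i]) (r1 r2 : nat -> R),
      (forall n : nat, (1 <= n)%N ->
         `|r1 n| + `|r2 n| <= M / (n%:R `^ nu) * Normc.normc (c n)) ->
    (forall m n, (0 < m)%N -> segint 0 T (fun t => (\sum_(m <= k < n)
         Rez (summand omega rho c r1 r2 k t)) ^+ 2) <=
       B * \sum_(m <= k < n) normc (c k) ^+ 2) /\
    (forall n, \sum_(1 <= k < n) normc (c k) ^+ 2 <=
       K * segint 0 T (fun t => (\sum_(1 <= k < n)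
         Rez (summand omega rho c r1 r2 k t)) ^+ 2))].
Proof.
have [T0 [T00 T0T hT0]] := critical_time alpha_omega_gt0 gamma_gt T_gt.
split; first exact: lt_trans T0T.
have [g [beta [N [g0 hbeta hb hlin hmono]]]] :=
  high_frequencies gap_omega lim_Im_omega gamma_gt0 alpha_omega_gt0 hT0.
have [hbZ hlinZ hgapZ] := freqZ_bounds g0 hb hlin hmono.
have frame0 := tail_frame rho g0 T00 hbeta hbZ hgapZ.
have Re_neq0 (k : int) : k != 0 -> Rez (freqZ omega k) != 0.
  move=> k0; have kN0 : - k != 0 by rewrite oppr_eq0.
  have kNk : k != - k by rewrite -addr_eq0 -mulr2n mulrn_eq0.
  have := omega_inj _ _ k0 kN0 kNk; rewrite freqZ_opp //.
  apply: contra => /eqP z; rewrite eq_complex cReN cImN cReJ cImJ opprK z oppr0.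
  by rewrite !eqxx.
have i_inj (z w : R[i]) : 'i%C * z = 'i%C * w -> z = w.
  by rewrite !iE => -[/oppr_inj e1 e2]; apply/eqP; rewrite eq_complex e1 e2 !eqxx.
have exponent_inj : {in (fun i => if i is inr n then (0 < n)%N else true) &,
    injective (exponent omega rho)}.
  have mixed (k : int) n : (0 < n)%N ->
      (if k == 0 then 0 else 'i%C * freqZ omega k) <> (rho n)%:C.
    move=> n0; case: eqVneq => [_ e|k0 e].
      by have := rho_neq0 n n0; case: e => <-; rewrite eqxx.
    by have := rho_omega n k n0 k0; rewrite e eqxx.
  move=> [k|m] [l|n]; rewrite !unfold_in /= => hk hl.
  - case: (eqVneq k 0) => [->|k0]; case: (eqVneq l 0) => [->|l0] // e.
    + have := omega_neq0 l l0; rewrite (i_inj (freqZ omega l) 0) ?eqxx //.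
      by rewrite -e mulr0.
    + have := omega_neq0 k k0; rewrite (i_inj (freqZ omega k) 0) ?eqxx //.
      by rewrite e mulr0.
    + case: (eqVneq k l) => [->//|kl].
      by have := omega_inj _ _ k0 l0 kl; rewrite (i_inj _ _ e) eqxx.
  - by move=> e; case: (mixed k n hl).
  - by move=> e; case: (mixed l m hk).
  - move=> [e]; case: (eqVneq m n) => [->//|mn].
    by have := rho_inj _ _ hk hl mn; rewrite e eqxx.
have [B B0 hB] := block_direct_inequality g0 T00 T0T hlinZ frame0
  exponent_inj lim_rho nu_gt M_gt0.
have [K K0 hK] := block_inverse_inequality g0 T00 T0T hlinZ frame0 Re_neq0
  exponent_inj lim_rho nu_gt M_gt0.
exists B, K; split => // c r1 r2 hr; split.
  by move=> m n m0; have := hB c r1 r2 m n m0 hr; rewrite energy_block.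
by move=> n; have := hK c r1 r2 n hr; rewrite energy_block.
Qed.

End PartialSums.

Section Limits.
Variable R : realType.

(** f^2 <= 2 h^2 + 2 (f - h)^2 pointwise. *)
Lemma L2_split (d : measure_display) (X : measurableType d)
  (mu : {measure set X -> \bar R}) (D : set X) (f h : X -> R) :
  measurable D -> measurable_fun D f -> measurable_fun D h ->
  (\int[mu]_(x in D) ((f x) ^+ 2)%:E <=
   2%:E * \int[mu]_(x in D) ((h x) ^+ 2)%:E +
   2%:E * \int[mu]_(x in D) ((f x - h x) ^+ 2)%:E)%E.
Proof.
move=> mD mf mh.
have mh2 : measurable_fun D (fun x => ((h x) ^+ 2)%:E).
  by apply/measurable_EFinP; exact: measurable_funX.
have mf2 : measurable_fun D (fun x => ((f x) ^+ 2)%:E).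
  by apply/measurable_EFinP; exact: measurable_funX.
have md2 : measurable_fun D (fun x => ((f x - h x) ^+ 2)%:E).
  by apply/measurable_EFinP; apply: measurable_funX; exact: measurable_funB.
have nh x : D x -> (0 <= ((h x) ^+ 2)%:E)%E by rewrite lee_fin sqr_ge0.
have nd x : D x -> (0 <= ((f x - h x) ^+ 2)%:E)%E by rewrite lee_fin sqr_ge0.
have n2h x : D x -> (0 <= 2%:E * ((h x) ^+ 2)%:E)%E.
  by move=> Dx; rewrite mule_ge0 ?nh // lee_fin.
have n2d x : D x -> (0 <= 2%:E * ((f x - h x) ^+ 2)%:E)%E.
  by move=> Dx; rewrite mule_ge0 ?nd // lee_fin.
have m2h := measurable_funeM 2%:E mh2; have m2d := measurable_funeM 2%:E md2.
rewrite -(ge0_integralZl mu mD mh2 nh) ?lee_fin //.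
rewrite -(ge0_integralZl mu mD md2 nd) ?lee_fin //.
rewrite -(ge0_integralD mu mD n2h m2h n2d m2d).
apply: ge0_le_integral => //.
- by move=> x _; rewrite lee_fin sqr_ge0.
- exact: emeasurable_funD.
- move=> x _; rewrite -!EFinM -EFinD lee_fin -subr_ge0.
  rewrite [X in 0 <= X](_ : _ = (f x - 2 * h x) ^+ 2); last by ring.
  exact: sqr_ge0.
Qed.

Lemma segint_oo (T : R) (h : R -> R) : continuous h ->
  (\int[lebesgue_measure]_(t in `]0%R, T[) (h t)%:E = (segint 0 T h)%:E)%E.
Proof.
move=> ch; rewrite segint_EFin // -(@integral_itv_bndoo R 0 T _ true false) //.
by apply/measurable_EFinP; apply: measurable_funTS; exact: continuous_measurable_fun.
Qed.

End Limits.

Unset Implicit Arguments.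

Theorem theorem3p7 (R : realType) (omega : nat -> R[i]) (rho : nat -> R)
  (gamma alpha_omega alpha_rho nu M T : R)
  (gamma_gt0 : 0 < gamma) (alpha_omega_gt0 : 0 < alpha_omega)
  (alpha_rho_lt0 : alpha_rho < 0)
  (gap_omega : limn_einf (fun n : nat =>
     (complex.Re (omega n.+1) - complex.Re (omega n))%:E) = gamma%:E)
  (lim_Im_omega : complex.Im (omega n) @[n --> \oo] --> alpha_omega)
  (lim_rho : rho n @[n --> \oo] --> alpha_rho)
  (gamma_gt : 4 * alpha_omega < gamma)
  (omega_neq0 : forall k : int, k != 0 -> freqZ omega k != 0)
  (omega_inj : forall k l : int, k != 0 -> l != 0 -> k != l ->
     freqZ omega k != freqZ omega l)
  (rho_neq0 : forall n : nat, (1 <= n)%N -> rho n != 0)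
  (rho_inj : forall m n : nat, (1 <= m)%N -> (1 <= n)%N -> m != n ->
     rho m != rho n)
  (rho_omega : forall (n : nat) (k : int), (1 <= n)%N -> k != 0 ->
     (rho n)%:C != 'i%C * freqZ omega k)
  (nu_gt : 1 / 2 < nu) (M_gt0 : 0 < M)
  (T_gt : 2 * pi / Num.sqrt (gamma ^+ 2 - 16 * alpha_omega ^+ 2) < T) :
  exists C : R, 0 < C /\
    forall (c : nat -> R[i]) (r1 r2 : nat -> R),
      (\sum_(1 <= n <oo) ((Normc.normc (c n)) ^+ 2)%:E < +oo)%E ->
      (forall n : nat, (1 <= n)%N ->
         `|r1 n| + `|r2 n| <= M / (n%:R `^ nu) * Normc.normc (c n)) ->
      let u := fun (n : nat) (t : R) =>
        complex.Re (summand omega rho c r1 r2 n t) in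
      (exists f : R -> R, L2_series_sum T u f) /\
      (forall f : R -> R, L2_series_sum T u f ->
         (C%:E * \sum_(1 <= n <oo)
            ((1 + expR (- 2 * complex.Im (omega n) * T))
               * (Normc.normc (c n)) ^+ 2)%:E
          <= \int[lebesgue_measure]_(t in `]0%R, T[) ((f t) ^+ 2)%:E)%E).
Proof.
have [T0 [B [K [B0 K0 ineqs]]]] := partial_sum_inequalities gamma_gt0
  alpha_omega_gt0 gap_omega lim_Im_omega lim_rho gamma_gt omega_neq0 omega_inj
  rho_neq0 rho_inj rho_omega nu_gt M_gt0 T_gt.
have [A A0 hA] := exists_upper_bound_near lim_Im_omega.
pose W := 1 + expR (2 * A * T).
have W0 : 0 < W by rewrite addr_gt0 ?expR_gt0.
have wW n : 1 + expR (- 2 * complex.Im (omega n) * T) <= W.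
  rewrite lerD2l ler_expR ler_wpM2r ?(ltW T0) // mulNr -mulrN ler_wpM2l //.
  by rewrite (le_trans _ (hA n)) // -normrN ler_norm.
(* The factor 2 comes from comparing f with a partial sum. *)
exists (2 * W * K)^-1; split; first by rewrite invr_gt0 mulr_gt0 // mulr_gt0.
move=> c r1 r2 c_fin hr u.
have [direct inverse] := ineqs c r1 r2 hr.
pose D : set R := `]0%R, T[%classic.
have mD : measurable D by exact: measurable_itv.
pose P n t := \sum_(1 <= k < n) u k t.
have cu k : continuous (u k).
  exact: summand_continuous.
have cP n : continuous (P n) by exact: continuous_sum.
have mP n : measurable_fun D (P n).
  by apply: measurable_funTS; exact: continuous_measurable_fun.
have cP2 m n : continuous (fun t => (\sum_(m <= k < n) u k t) ^+ 2).
  have cS : continuous (fun t => \sum_(m <= k < n) u k t) by exact: continuous_sum.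
  by move=> t; under eq_fun do rewrite expr2; apply: continuousM; exact: cS.
pose a n := \sum_(1 <= k < n) normc (c k) ^+ 2.
have a_mono : nondecreasing_seq a.
  apply/nondecreasing_seqP => n; rewrite /a; case: n => [|n].
    by rewrite !big_geq.
  by rewrite [leRHS]big_nat_recr //= lerDl sqr_ge0.
have a_cvg : cvgn a.
  apply: nondecreasing_is_cvgn => //.
  exists (fine (\sum_(1 <= n <oo) ((Normc.normc (c n)) ^+ 2)%:E)%E).
  move=> _ [n _ <-]; rewrite -lee_fin fineK; last first.
    rewrite ge0_fin_numE // nneseries_ge0 // => k _ _.
    by rewrite lee_fin sqr_ge0.
  rewrite /a -sumEFin; apply: nneseries_lim_ge => k _ _.
  by rewrite lee_fin sqr_ge0.
have /cvg_ex[l a_l] := a_cvg.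
have cauchy (e : R) : 0 < e -> exists N, forall m n, (N <= m)%N -> (N <= n)%N ->
    (\int[lebesgue_measure]_(x in D) ((P m x - P n x) ^+ 2)%:E <= e%:E)%E.
  move=> e0; have d0 : 0 < e / (2 * B) by rewrite divr_gt0 ?mulr_gt0.
  have [N hN] := cvg_dist_near a_l d0; exists N.+1.
  have main m n : (0 < m)%N -> (N <= m <= n)%N ->
      (\int[lebesgue_measure]_(x in D) ((P n x - P m x) ^+ 2)%:E <= e%:E)%E.
    move=> m0 /andP[Nm mn].
    have splitm (F : nat -> R) :
      \sum_(1 <= k < n) F k = \sum_(1 <= k < m) F k + \sum_(m <= k < n) F k.
      exact: big_cat_nat.
    under eq_integral do rewrite /P splitm addrAC subrr add0r.
    rewrite segint_oo // lee_fin; apply: (le_trans (direct m n m0)).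
    have -> : \sum_(m <= k < n) normc (c k) ^+ 2 = a n - a m.
      by rewrite /a splitm addrAC subrr add0r.
    have h1 := hN m Nm; have h2 := hN n (leq_trans Nm mn).
    rewrite -ler_pdivlMl //.
    rewrite (_ : B^-1 * e = e / (2 * B) + e / (2 * B)); last first.
      by field; exact: lt0r_neq0.
    rewrite -[leLHS](subrKA l); apply: lerD.
      exact: le_trans (ler_norm _) h2.
    by rewrite distrC in h1; exact: le_trans (ler_norm _) h1.
  move=> m n Nm Nn; have m0 : (0 < m)%N by exact: leq_trans Nm.
  have n0 : (0 < n)%N by exact: leq_trans Nn.
  case: (leqP n m) => nm; first by apply: main => //; rewrite nm (ltnW Nn).
  under eq_integral do rewrite -sqrrN opprB.
  by apply: main => //; rewrite (ltnW nm) (ltnW Nm).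
have IP n : (\int[lebesgue_measure]_(x in D) ((P n x) ^+ 2)%:E < +oo)%E.
  by rewrite segint_oo ?ltry //; exact: cP2.
split.
  have muD : (lebesgue_measure D < +oo)%E.
    by rewrite lebesgue_measure_itv /= lte_fin; case: ifP => _; rewrite ltry.
  have [f mf hf] :=
    @L2_complete R _ _ (@lebesgue_measure R) D mD muD P mP cauchy.
  exists f; split => //.
    have [N hN] := hf 1 ltr01.
    apply: le_lt_trans (L2_split (@lebesgue_measure R) mD mf (mP N)) _.
    rewrite lte_add_pinfty // lte_mul_pinfty ?lee_fin //.
    by rewrite (le_lt_trans (hN N (leqnn N))) // ltry.
  apply/fine_cvgP; split.
    have [N hN] := hf 1 ltr01; exists N => // n Nn.
    rewrite ge0_fin_numE; last by apply: integral_ge0 => x _; rewrite lee_fin sqr_ge0.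
    by rewrite (le_lt_trans (hN n Nn)) // ltry.
  apply/cvgrPdist_le => e e0; have [N hN] := hf e e0; exists N => // n Nn.
  have I0 : (0 <= \int[lebesgue_measure]_(x in D) ((f x - P n x) ^+ 2)%:E)%E.
    by apply: integral_ge0 => x _; rewrite lee_fin sqr_ge0.
  rewrite sub0r normrN /= ger0_norm ?fine_ge0 //.
  rewrite -lee_fin fineK; first exact: hN.
  by rewrite ge0_fin_numE // (le_lt_trans (hN n Nn)) // ltry.
move=> f [mf f_fin f_cvg].
set If := (\int[lebesgue_measure]_(t in D) ((f t) ^+ 2)%:E)%E.
have If0 : (0 <= If)%E by apply: integral_ge0 => x _; rewrite lee_fin sqr_ge0.
have WK0 : 0 < 2 * W * K by rewrite mulr_gt0 // mulr_gt0.
rewrite lee_pdivrMl //.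
have w0 k : (0 <= ((1 + expR (- 2 * complex.Im (omega k) * T)) *
     (Normc.normc (c k)) ^+ 2)%:E)%E.
  by rewrite lee_fin mulr_ge0 ?sqr_ge0 // addr_ge0 ?expR_ge0.
apply: lime_le; first by apply: is_cvg_nneseries => k _ _; exact: w0.
apply: nearW => n0; apply/lee_addgt0Pr => e e0.
have : \forall n \near \oo, (\int[lebesgue_measure]_(t in D)
    ((f t - P n t) ^+ 2)%:E <= (e / (2 * W * K))%:E)%E.
  have /fine_cvgP[fin /cvgrPdist_le cv] := f_cvg.
  have d0 : 0 < e / (2 * W * K) by rewrite divr_gt0.
  have := cv _ d0; apply: filterS2 fin => n fn.
  rewrite sub0r normrN => h; rewrite -(fineK fn) lee_fin.
  exact: le_trans (ler_norm _) h.
move=> [N _ hN]; pose n := maxn n0 N.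
have hn := hN n (leq_maxr _ _).
apply: (@le_trans _ _ (W * K * segint 0 T (fun t => (P n t) ^+ 2))%:E).
  rewrite sumEFin lee_fin -mulrA.
  apply: (@le_trans _ _ (W * a n)); last by rewrite ler_pM2l // inverse.
  apply: (@le_trans _ _ (W * a n0)); last first.
    by rewrite ler_pM2l //; apply: a_mono; exact: leq_maxl.
  rewrite /a mulr_sumr; apply: ler_sum => k _.
  by rewrite ler_wpM2r ?sqr_ge0.
rewrite EFinM -segint_oo; last exact: cP2.
have := L2_split (@lebesgue_measure R) mD (mP n) mf.
under [X in (_ <= _ + _ * X)%E -> _]eq_integral do rewrite -sqrrN opprB.
move=> h; have WK1 : 0 < W * K by rewrite mulr_gt0.
apply: (@le_trans _ _ ((W * K)%:E * (2%:E * If + 2%:E * (e / (2 * W * K))%:E))%E).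
  rewrite lee_pmul2l //; apply: (le_trans h).
  by rewrite leeD2l // lee_pmul2l.
rewrite -(fineK (_ : If \is a fin_num)) ?ge0_fin_numE //.
move: (fine If) => y.
rewrite [leLHS](_ : _ = (W * K * (2 * y + 2 * (e / (2 * W * K))))%:E) //.
rewrite [leRHS](_ : _ = (2 * W * K * y + e)%:E) // lee_fin le_eqVlt.
apply/orP; left; apply/eqP.
have WN := lt0r_neq0 W0; have KN := lt0r_neq0 K0.
by field; rewrite WN KN.
Qed.
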